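(* Let $Q\subset\mathbb{R}^n$ be an $n$-dimensional lattice polytope all of whose vertices lie in $(2\mathbb{N})^n$, let $y\in\operatorname{int}(Q)\cap\mathbb{N}^n$, and let $f\in AP_Q^y$ be an agiform. Let $Q=Q_1^{(i)}\cup\dots\cup Q_{r(i)}^{(i)}$, $1\le i\le t$, be all the triangulations of $Q$ without new vertices. Then $\operatorname{SOS}(f,y)=C(y)$ (i.e. every agiform $f(Q,\lambda,y)$, $\lambda\in C(y)$, is a sum of squares) if and only if for every $1\le i\le t$ and $1\le j\le r(i)$ the following implication holds: $$y\in Q_j^{(i)}\ \Longrightarrow\ y\in (Q_j^{(i)})^*.$$
   Context: $\mathbb{N}=\{0,1,2,\dots\}$. Let $v_0,\dots,v_s$ be the vertices of $Q$. $AP_Q^y$ is the set of real polynomials of the form $\sum_{i=0}^s b_i\mathbf{x}^{v_i}+c\,\mathbf{x}^y$, supported on the vertices of $Q$ and the interior lattice point $y$. Such a polynomial is an agiform if $b_i>0$ for all $i$, $\sum_i b_i=1$, $\sum_i b_i v_i=y$ and $c=-1$. $C(y)=\{\lambda=(\lambda_0,\dots,\lambda_s): y=\sum_{i=0}^s\lambda_i v_i,\ \sum_{i=0}^s\lambda_i=1,\ \lambda_i\ge0\}$; for $\lambda\in C(y)$, $f(Q,\lambda,y)=\sum_{i=0}^s\lambda_i\mathbf{x}^{v_i}-\mathbf{x}^y$; and, with $Q=\operatorname{New}(f)$ the Newton polytope of $f$, $\operatorname{SOS}(f,y)=\{\lambda\in C(y): f(Q,\lambda,y)\text{ is a sum of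 squares of real polynomials}\}$. A triangulation without new vertices is a triangulation of $Q$ into $n$-dimensional simplices all of whose vertices are vertices of $Q$; $Q_1^{(i)},\dots,Q_{r(i)}^{(i)}$ are the $n$-simplices of the $i$-th triangulation. For a lattice simplex $\Delta$ with even vertices and vertex set $\hat\Delta$: for $L\subseteq\Delta\cap\mathbb{Z}^n$ put $\overline{A}(L)=\{\tfrac12(u+w)\in\mathbb{Z}^n: u\ne w,\ u,w\in L\cap(2\mathbb{Z})^n\}$; $L$ is $\hat\Delta$-mediated if $\hat\Delta\subseteq L\subseteq\overline{A}(L)\cup\hat\Delta$; $\Delta^*$ denotes the (unique) maximal $\hat\Delta$-mediated set, which contains every $\hat\Delta$-mediated set. *)

(* Defs.v *)
From HB Require Import structures.
From mathcomp Require Import all_boot all_order all_algebra finmap mpoly.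
From mathcomp Require Import all_classical reals topology normedtype.

Set Implicit Arguments.
Unset Strict Implicit.
Unset Printing Implicit Defensive.

Import Order.TTheory GRing.Theory Num.Theory.
Import numFieldNormedType.Exports.

Local Open Scope classical_set_scope.
Local Open Scope ring_scope.

Section Points.
Variables (R : realType) (n : nat).

Definition zpoint (u : 'rV[int]_n) : 'rV[R]_n := map_mx (fun z : int => z%:~R) u.

Definition mexponent (m : 'X_{1..n}) : 'rV[int]_n := \row_i (m i)%:Z.

Definition mpoint (m : 'X_{1..n}) : 'rV[R]_n := zpoint (mexponent m).

End Points.

Arguments zpoint R {n} u.
Arguments mpoint R {n} m.

Section Polytopes.
Variables (R : realType) (n : nat).
Implicit Types (A P Q S W : set 'rV[R]_n) (T : set (set 'rV[R]_n)).

(* The weights summing to 1 force k > 0, so the hull of set0 is set0. *)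
Definition conv_hull A : set 'rV[R]_n :=
  [set p | exists (k : nat) (w : 'I_k -> R) (x : 'I_k -> 'rV[R]_n),
     [/\ forall i, 0 <= w i, \sum_i w i = 1, forall i, A (x i)
       & p = \sum_i w i *: x i]].

(* Extreme points; for a polytope these are its vertices. *)
Definition vertices P : set 'rV[R]_n :=
  [set p | P p /\ forall (a b : 'rV[R]_n) (t : R), P a -> P b -> 0 < t < 1 ->
     p = t *: a + (1 - t) *: b -> a = p /\ b = p].

Definition aff_indep (k : nat) (w : 'I_k.+1 -> 'rV[R]_n) : bool :=
  row_free (\matrix_(i < k) (w (lift ord0 i) - w ord0)).

Definition lattice_polytope Q : Prop :=
  exists V : set 'rV[int]_n, finite_set V /\ Q = conv_hull (zpoint R @` V).

Definition full_dimensional Q : Prop :=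
  exists w : 'I_n.+1 -> 'rV[R]_n, aff_indep w /\ range w `<=` Q.

Definition full_simplex S : Prop :=
  exists w : 'I_n.+1 -> 'rV[R]_n, aff_indep w /\ S = conv_hull (range w).

(* A triangulation is the set of its n-simplices.  The faces of a simplex are
   the hulls of the sets of its vertices, set0 included, so the last condition
   says that two simplices meet in a common, possibly empty, face. *)
Definition triangulation_without_new_vertices Q T : Prop :=
  [/\ finite_set T,
      forall S, T S -> full_simplex S /\ vertices S `<=` vertices Q,
      \bigcup_(S in T) S = Q
    & forall S S', T S -> T S' ->
        exists W, W `<=` vertices S `&` vertices S' /\ S `&` S' = conv_hull W].

End Polytopes.

Section Mediated.
Variables (R : realType) (n : nat).
Implicit Types (D : set 'rV[R]_n) (L : set 'rV[int]_n).

Definition even_point (u : 'rV[int]_n) : Prop := forall i, (2 %| u ord0 i)%Z.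

Definition even_midpoints L : set 'rV[int]_n :=
  [set a | exists u w, [/\ u <> w, L u /\ even_point u, L w /\ even_point w
                         & a *+ 2 = u + w]].

Definition lattice_vertices D : set 'rV[int]_n :=
  [set u | vertices D (zpoint R u)].

Definition mediated D L : Prop :=
  [/\ L `<=` [set u | D (zpoint R u)], lattice_vertices D `<=` L
    & L `<=` even_midpoints L `|` lattice_vertices D].

(* The union of all mediated sets; max_mediatedP shows that it is the greatest
   mediated set. *)
Definition max_mediated D : set 'rV[int]_n :=
  \bigcup_(L in [set L | mediated D L]) L.

Lemma max_mediatedP D :
  mediated D (max_mediated D) /\
  forall L, mediated D L -> L `<=` max_mediated D.
Proof.
have sub L : mediated D L -> L `<=` max_mediated D by move=> ML u Lu; exists L.
have MV : mediated D (lattice_vertices D).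
  by split; [move=> u []|move=> u|move=> u; right].
split=> //; split.
- by move=> u [L [LD _ _]] Lu; exact: LD.
- exact: (sub _ MV).
- move=> u [L ML Lu]; have [_ _ /(_ u Lu)] := ML.
  case=> [[a [b [ab [La ea] [Lb eb] uE]]]|]; last by right.
  left; exists a, b; split=> //; split=> //; exact: (sub L).
Qed.

End Mediated.

Section Agiforms.
Variables (R : realType) (n : nat).
Implicit Types (Q : set 'rV[R]_n) (y : 'X_{1..n}) (f g : {mpoly R[n]}).
Implicit Types (b lambda : 'X_{1..n} -> R) (c : R).

Definition vertex_monomials Q : set 'X_{1..n} :=
  [set m | vertices Q (mpoint R m)].

Definition ap_poly Q y b c : {mpoly R[n]} :=
  \sum_(v \in vertex_monomials Q) b v *: 'X_[v] + c *: 'X_[y].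

Definition AP Q y : set {mpoly R[n]} := [set f | exists b c, f = ap_poly Q y b c].

Definition agiform Q y f : Prop :=
  exists b c,
    [/\ f = ap_poly Q y b c,
        forall v, vertex_monomials Q v -> 0 < b v,
        \sum_(v \in vertex_monomials Q) b v = 1,
        \sum_(v \in vertex_monomials Q) b v *: mpoint R v = mpoint R y
      & c = -1].

(* The tuple (lambda_0, ..., lambda_s) is indexed by the vertices themselves:
   it is a function on exponents which is zero off the vertices of Q. *)
Definition barycentric_weights Q y : set ('X_{1..n} -> R) :=
  [set lambda |
    [/\ \sum_(v \in vertex_monomials Q) lambda v *: mpoint R v = mpoint R y,
        \sum_(v \in vertex_monomials Q) lambda v = 1,
        forall v, 0 <= lambda v
      & forall v, ~ vertex_monomials Q v -> lambda v = 0]].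

Definition weighted_agiform Q lambda y : {mpoly R[n]} :=
  \sum_(v \in vertex_monomials Q) lambda v *: 'X_[v] - 'X_[y].

Definition sum_of_squares g : Prop :=
  exists s : seq {mpoly R[n]}, g = \sum_(q <- s) q ^+ 2.

Definition newton_polytope f : set 'rV[R]_n :=
  conv_hull (mpoint R @` [set` msupp f]).

Definition SOS_weights f y : set ('X_{1..n} -> R) :=
  [set lambda | barycentric_weights (newton_polytope f) y lambda /\
     sum_of_squares (weighted_agiform (newton_polytope f) lambda y)].

End Agiforms.

(* Main.v *)
Require Import Defs.
From HB Require Import structures.
From mathcomp Require Import all_boot all_order all_algebra finmap mpoly.
From mathcomp Require Import all_classical reals topology normedtype.
From mathcomp Require Import ring lra zify.

Set Implicit Arguments.
Unset Strict Implicit.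
Unset Printing Implicit Defensive.

Import Order.TTheory GRing.Theory Num.Theory.
Import numFieldNormedType.Exports.

Local Open Scope classical_set_scope.
Local Open Scope ring_scope.

(** The support of an agiform [f] spans [Q], so the left-hand side says that for
    every convex representation [l] of [y] by the vertices of [Q] the polynomial
    sum_j l_j X^(m_j) - X^y is a sum of squares.  Three facts decide this.

    Simplices.  Let [y] lie in a simplex with vertices w_0, ..., w_n, let f_u be
    the agiform sum_i l_i X^(w_i) - X^u given by the barycentric coordinates of
    [u].  If f_y is a sum of squares, the doubled exponents of the summands
    together with [y] and the vertices are mediated, because an exponent with
    nonpositive coefficient must arise from a mixed product ([sos_mediated]).
    Conversely, let [y] belong to a mediated set.  If u = (2a + 2b) / 2 then
    f_u = (f_(2a) + f_(2b)) / 2 + (X^a - X^b)^2 / 2, a linear system in which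
    f_y turns out to be a nonnegative combination of the squares
    ([mediated_sos]).  In both directions the key is one minimum principle
    ([midpoint_min]): a function on a finite set of lattice points which at each
    point is nonnegative or at least the mean of its values at two distinct
    points of the set symmetric about it, is nonnegative.

    Reduction to simplices.  The convex representations of [y] form a polytope
    whose extreme points have affinely independent support
    ([indep_support_ind]), and sums of squares form a convex cone, so only
    affinely independent supports matter.

    Triangulations.  Any affinely independent set of vertices lies in a simplex
    of some triangulation of [Q] without new vertices
    ([extend_to_triangulation]).  It is completed to an affine basis, and the
    regular triangulation induced by heights that vanish on this basis and are
    positive and generic elsewhere is taken.  The simplices of that triangulation
    are the bases whose interpolating affine function stays below the heights;
    the dual simplex method shows that they cover [Q] ([lower_cover]), and
    comparing two interpolating functions shows that they meet in common faces
    ([lower_meet]). *)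

(** * Homogeneous coordinates and convex hulls *)

Section Homogenisation.
Variables (R : realType) (n : nat).
Implicit Types (p : 'rV[R]_n).

(** Prefixing a point with the coordinate 1 turns affine relations into linear
    ones: [l *m hmat x = hvec p] says at once that the weights [l] sum to 1 and
    that the combination of the points [x i] is [p]. *)
Definition hpair (c : R) p : 'rV[R]_n.+1 :=
  \row_j oapp (p 0) c (unlift ord0 j).

Definition hvec p : 'rV[R]_n.+1 := hpair 1 p.

Definition hmat k (x : 'I_k -> 'rV[R]_n) : 'M[R]_(k, n.+1) :=
  \matrix_(i < k) hvec (x i).

Lemma hpair_inj c d p q : hpair c p = hpair d q -> c = d /\ p = q.
Proof.
move=> /rowP E; split; first by have := E ord0; rewrite !mxE unlift_none.
by apply/rowP => j; have := E (lift ord0 j); rewrite !mxE liftK.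
Qed.

Lemma hvec_inj : injective hvec.
Proof. by move=> p q /hpair_inj[]. Qed.

Lemma hpair0 : hpair 0 0 = 0.
Proof.
by apply/rowP => j; rewrite !mxE; case: unliftP => [i _|_] //=; rewrite mxE.
Qed.

Lemma hpair_eq0 c p : hpair c p = 0 -> c = 0 /\ p = 0.
Proof. by move=> E; apply: hpair_inj; rewrite E hpair0. Qed.

Lemma mul_hmat k (l : 'rV[R]_k) (x : 'I_k -> 'rV[R]_n) :
  l *m hmat x = hpair (\sum_i l 0 i) (\sum_i l 0 i *: x i).
Proof.
apply/rowP => j; rewrite !mxE; case: unliftP => [i ->|->] /=.
  by rewrite summxE; apply: eq_bigr => m _; rewrite !mxE liftK.
by apply: eq_bigr => m _; rewrite !mxE unlift_none mulr1.
Qed.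

Lemma hmatP k (l : 'rV[R]_k) (x : 'I_k -> 'rV[R]_n) p :
  l *m hmat x = hvec p <-> \sum_i l 0 i = 1 /\ \sum_i l 0 i *: x i = p.
Proof. by rewrite mul_hmat; split=> [/hpair_inj|[-> ->] //]. Qed.

Lemma aff_indepE (w : 'I_n.+1 -> 'rV[R]_n) :
  aff_indep w = (hmat w \in unitmx).
Proof.
have sum0 (v : 'rV[R]_n) : v *m (\matrix_(i < n) (w (lift ord0 i) - w ord0)) =
    \sum_i v 0 i *: w (lift ord0 i) - (\sum_i v 0 i) *: w ord0.
  rewrite mulmx_sum_row scaler_suml -sumrB; apply: eq_bigr => i _.
  by rewrite rowK scalerBr.
rewrite -row_free_unit /aff_indep; apply/idP/idP => fr; apply: inj_row_free => v.
  rewrite mul_hmat => /hpair_eq0[].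
  rewrite !big_ord_recl => /eqP; rewrite addr_eq0 => /eqP v0 vw.
  have: (\row_i v 0 (lift ord0 i)) *m
      (\matrix_(i < n) (w (lift ord0 i) - w ord0)) = 0.
    rewrite sum0; under eq_bigr do rewrite mxE.
    under [X in _ - X *: _]eq_bigr do rewrite mxE.
    by rewrite -[RHS]vw v0 scaleNr addrC.
  move/eqP; rewrite mulmx_free_eq0 // => /eqP/rowP vl.
  have vl0 i : v 0 (lift ord0 i) = 0 by have := vl i; rewrite !mxE.
  apply/rowP => i; rewrite [RHS]mxE; case: (unliftP ord0 i) => [j|] ->; first exact: vl0.
  by rewrite v0 big1 ?oppr0.
rewrite sum0 => vw.
(* A relation between the differences becomes an affine relation once the point
   w ord0 receives the opposite of the total weight. *)
pose u : 'rV[R]_n.+1 :=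
  \row_i oapp (fun j => v 0 j) (- \sum_j v 0 j) (unlift ord0 i).
have uE j : u 0 (lift ord0 j) = v 0 j by rewrite mxE liftK.
have u0 : u 0 ord0 = - \sum_j v 0 j by rewrite mxE unlift_none.
have : u *m hmat w = 0.
  rewrite mul_hmat !big_ord_recl.
  under eq_bigr do rewrite uE; under [X in _ *: _ + X]eq_bigr do rewrite uE.
  rewrite u0.
  by rewrite addNr scaleNr addrC vw hpair0.
move/eqP; rewrite mulmx_free_eq0 // => /eqP uz.
by apply/rowP => j; rewrite -uE uz !mxE.
Qed.

(** Repeated points in a convex combination are merged, so over a finite family
    one weight per index is enough. *)
Lemma conv_hull_rangeP k (x : 'I_k -> 'rV[R]_n) p :
  conv_hull (range x) p <->
  exists l : 'rV[R]_k, (forall i, 0 <= l 0 i) /\ l *m hmat x = hvec p.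
Proof.
split=> [[m [w [z [w0 w1 zx ->]]]]|[l [l0 /hmatP[l1 lx]]]]; last first.
  by exists k, (l 0), x; split=> // i; exists i.
have /choice[f fz] i : exists j, x j = z i by case: (zx i) => j _; exists j.
exists (\row_j \sum_(i | f i == j) w i); split=> [j|].
  by rewrite mxE sumr_ge0.
apply/hmatP; split.
  under eq_bigr do rewrite mxE.
  by rewrite -w1 [RHS](partition_big f xpredT).
rewrite [RHS](partition_big f xpredT) //=; apply: eq_bigr => j _.
rewrite mxE scaler_suml; apply: eq_bigr => i /eqP <-; by rewrite fz.
Qed.

Lemma conv_hull_sub (A : set 'rV[R]_n) : A `<=` conv_hull A.
Proof.
move=> p Ap; exists 1%N, (fun _ => 1), (fun _ => p).
by split=> //; rewrite big_ord1 ?scale1r.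
Qed.

Lemma conv_hull_mono (A B : set 'rV[R]_n) :
  A `<=` B -> conv_hull A `<=` conv_hull B.
Proof.
move=> AB p [k [w [x [w0 w1 Ax ->]]]]; exists k, w, x; split=> // i; exact: AB.
Qed.

Lemma conv_hull_min k (x : 'I_k -> 'rV[R]_n) (A : set 'rV[R]_n) :
  A `<=` conv_hull (range x) -> conv_hull A `<=` conv_hull (range x).
Proof.
move=> Ax p [m [w [z [w0 w1 Az ->]]]].
have /choice[l lP] i : exists l : 'rV[R]_k,
    (forall j, 0 <= l 0 j) /\ l *m hmat x = hvec (z i).
  exact/conv_hull_rangeP/Ax.
apply/conv_hull_rangeP; exists (\sum_i w i *: l i); split=> [j|].
  rewrite summxE sumr_ge0 // => i _; rewrite mxE mulr_ge0 //; exact: (lP i).1.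
have -> : \sum_i w i *: l i = (\row_i w i) *m \matrix_i l i.
  by rewrite mulmx_sum_row; apply: eq_bigr => i _; rewrite rowK mxE.
rewrite -mulmxA.
have -> : (\matrix_i l i) *m hmat x = hmat z.
  by apply/row_matrixP => i; rewrite row_mul !rowK (lP i).2.
apply/hmatP; split; first by rewrite -w1; apply: eq_bigr => i _; rewrite mxE.
by apply: eq_bigr => i _; rewrite mxE.
Qed.

End Homogenisation.

(** * Extreme points *)

Section Extreme.
Variables (R : realType) (n : nat).
Implicit Types (p : 'rV[R]_n).

Lemma hvecD (t : R) p q :
  hvec (t *: p + (1 - t) *: q) = t *: hvec p + (1 - t) *: hvec q.
Proof.
apply/rowP => j; rewrite !mxE; case: unliftP => [i _|_] /=; first by rewrite !mxE.
by rewrite !mulr1 addrC subrK.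
Qed.

Lemma delta_hmat k (x : 'I_k -> 'rV[R]_n) i :
  delta_mx 0 i *m hmat x = hvec (x i).
Proof. by rewrite -rowE rowK. Qed.

Lemma weight_le1 k (l : 'rV[R]_k) :
  (forall i, 0 <= l 0 i) -> \sum_i l 0 i = 1 -> forall i, l 0 i <= 1.
Proof.
by move=> l0 <- i; rewrite (bigD1 i) //= lerDl sumr_ge0.
Qed.

Lemma weight_eq1 k (l : 'rV[R]_k) i :
  (forall i, 0 <= l 0 i) -> \sum_i l 0 i = 1 -> l 0 i = 1 -> l = delta_mx 0 i.
Proof.
move=> l0 l1 li; apply/rowP => j; rewrite mxE eqxx /=.
case: eqVneq => [->//|ji] /=.
apply/eqP; rewrite eq_le l0 andbT.
move: l1; rewrite (bigD1 i) // (bigD1 j) //= li.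
have: 0 <= \sum_(m | (m != i) && (m != j)) l 0 m by apply: sumr_ge0.
lra.
Qed.

(** The unit weight vectors are extreme among weight vectors, which is how
    extremality of a point is read off its coordinates. *)
Lemma weight_delta_extreme k (a b : 'rV[R]_k) (t : R) i :
  (forall i, 0 <= a 0 i) -> \sum_i a 0 i = 1 ->
  (forall i, 0 <= b 0 i) -> \sum_i b 0 i = 1 -> 0 < t < 1 ->
  (t *: a + (1 - t) *: b) 0 i = 1 -> a = delta_mx 0 i /\ b = delta_mx 0 i.
Proof.
move=> a0 a1 b0 b1 /andP[t0 t1]; rewrite !mxE => E.
have ai := weight_le1 a0 a1 i; have bi := weight_le1 b0 b1 i.
have a1' : a 0 i = 1 by nra.
have b1' : b 0 i = 1 by nra.
by split; apply: weight_eq1.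
Qed.

Lemma vertices_conv_hull (A : set 'rV[R]_n) : vertices (conv_hull A) `<=` A.
Proof.
move=> p [[k [w [x [w0 w1 Ax pE]]]] ext].
have [i wi] : exists i, 0 < w i.
  apply: contrapT => /forallNP wn.
  have : \sum_i w i <= 0 by apply: sumr_le0 => i _; rewrite leNgt; apply/negP.
  by rewrite w1 ler10.
have [wi1|wi1] := ltP (w i) 1; last first.
  have wr0 : (\row_j w j) 0 i = 1.
    apply/eqP; rewrite eq_le [X in _ && (_ <= X)]mxE wi1 andbT.
    apply: weight_le1 => [j|]; first by rewrite mxE.
    by rewrite -w1; apply: eq_bigr => j _; rewrite mxE.
  have E : \row_j w j = delta_mx 0 i.
    apply: weight_eq1 => // [j|]; first by rewrite mxE.
    by rewrite -w1; apply: eq_bigr => j _; rewrite mxE.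
  rewrite pE (bigD1 i) //= big1 ?addr0 => [|j ji].
    by have := congr1 (fun M : 'rV_k => M 0 i) E; rewrite !mxE !eqxx /= => ->;
      rewrite scale1r.
  by have := congr1 (fun M : 'rV_k => M 0 j) E;
    rewrite !mxE eqxx (negPf ji) /= => ->; rewrite scale0r.
(* p lies strictly between x i and the normalised combination of the others. *)
have wi1' : 1 - w i != 0 by rewrite subr_eq0 eq_sym lt_eqF.
have [||||<- _ //] := ext (x i)
    (\sum_j (if j == i then 0 else w j / (1 - w i)) *: x j) (w i).
- exact: conv_hull_sub.
- exists k, (fun j => if j == i then 0 else w j / (1 - w i)), x; split=> //.
    by move=> j; case: ifP => // _; rewrite divr_ge0 // subr_ge0 ltW.
  rewrite (bigD1 i) //= eqxx add0r.
  rewrite (eq_bigr (fun j => w j / (1 - w i))) => [|j /negPf -> //].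
  rewrite -mulr_suml; apply: (mulIf wi1'); rewrite divfK // mul1r.
  by rewrite -w1 [X in _ = X - _](bigD1 i) //= addrC addrK.
- by rewrite wi.
- rewrite pE scaler_sumr (bigD1 i) //=; congr (_ + _).
  rewrite [RHS](bigD1 i) //= eqxx scale0r scaler0 add0r.
  by apply: eq_bigr => j /negPf ->; rewrite scalerA mulrCA divff ?mulr1.
Qed.

(** Barycentric coordinates are unique, so a splitting of a vertex of the simplex
    is a splitting of a unit weight vector. *)
Lemma simplex_vertices (w : 'I_n.+1 -> 'rV[R]_n) :
  hmat w \in unitmx -> vertices (conv_hull (range w)) = range w.
Proof.
move=> uw; apply/seteqP; split; first exact: vertices_conv_hull.
move=> _ [i _ <-]; split; first by apply: conv_hull_sub; exists i.
move=> a b t /conv_hull_rangeP[la [la0 aE]] /conv_hull_rangeP[lb [lb0 bE]] t01 E.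
have := congr1 (@hvec R n) E; rewrite hvecD -aE -bE -delta_hmat.
rewrite !scalemxAl -mulmxDl => /(can_inj (mulmxK uw)) tE.
have [/hmatP[a1 _] /hmatP[b1 _]] := (aE, bE).
have [|ea eb] := weight_delta_extreme (i := i) la0 a1 lb0 b1 t01.
  by rewrite -tE !mxE !eqxx.
by split; apply: hvec_inj; rewrite -?aE -?bE ?ea ?eb delta_hmat.
Qed.

(** Minkowski's theorem for a finite generating family: a generator kept in an
    inclusion-minimal generating subfamily cannot lie strictly between two
    points of the hull, since otherwise it could be expressed by the others and
    dropped. *)
Lemma conv_hull_vertices k (x : 'I_k -> 'rV[R]_n) :
  conv_hull (range x) `<=` conv_hull (vertices (conv_hull (range x))).
Proof.
set Q := conv_hull (range x).
pose gen (J : {set 'I_k}) := `[< forall p, Q p -> exists l : 'rV[R]_k,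
  [/\ forall i, 0 <= l 0 i, l *m hmat x = hvec p
    & forall i, i \notin J -> l 0 i = 0] >].
have genT : gen [set: 'I_k]%SET.
  apply/asboolP => p /conv_hull_rangeP[l [l0 lp]]; exists l; split=> // i.
  by rewrite inE.
have [J /minsetP[/asboolP genJ minJ] _] := minset_exists genT.
have vJ i : i \in J -> vertices Q (x i).
  move=> iJ; split; first by apply: conv_hull_sub; exists i.
  move=> a b t /genJ[la [la0 aE aJ]] /genJ[lb [lb0 bE bJ]] t01 E.
  have [/hmatP[a1 _] /hmatP[b1 _]] := (aE, bE).
  pose g := t *: la + (1 - t) *: lb.
  have /andP[t0 t1] := t01.
  have gE : g *m hmat x = hvec (x i).
    by rewrite mulmxDl -!scalemxAl aE bE -hvecD -E.
  have /hmatP[g1 _] := gE.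
  have g0 j : 0 <= g 0 j.
    by rewrite !mxE addr_ge0 // mulr_ge0 // ?subr_ge0 ltW.
  have gJ j : j \notin J -> g 0 j = 0.
    by move=> jJ; rewrite !mxE aJ // bJ // !mulr0 addr0.
  have gi : g 0 i = 1.
    clearbody g; apply/eqP; rewrite eq_le weight_le1 //= leNgt.
    apply/negP => gi1.
    have : gen (J :\ i)%SET.
      apply/asboolP => p /genJ[d [d0 dE dJ]].
      (* The coefficient of x i in p is spread over the other generators. *)
      pose c := d 0 i / (1 - g 0 i).
      have c0 : 0 <= c by rewrite divr_ge0 // subr_ge0 ltW.
      have cE : d 0 i + c * (g 0 i - 1) = 0.
        rewrite -(opprB 1) mulrN divfK ?subrr //.
        by rewrite subr_eq0 eq_sym lt_eqF.
      have entry j : (d + c *: (g - delta_mx 0 i)) 0 j =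
          if j == i then 0 else d 0 j + c * g 0 j.
        rewrite !mxE eqxx /=; case: (eqVneq j i) => [->|_] //=.
        by rewrite subr0.
      exists (d + c *: (g - delta_mx 0 i)); split=> [j||j].
      - by rewrite entry; case: ifP => // _; rewrite addr_ge0 // mulr_ge0.
      - by rewrite mulmxDl -scalemxAl mulmxBl gE delta_hmat subrr scaler0 addr0.
      - rewrite !inE entry; case: ifP => //= _ jJ.
        by rewrite dJ // gJ // mulr0 addr0.
    move=> /minJ /(_ (subsetDl _ _)) JE.
    by move: iJ; rewrite -JE !inE eqxx.
  have [ea eb] := weight_delta_extreme la0 a1 lb0 b1 t01 gi.
  by split; apply: hvec_inj; rewrite -?aE -?bE ?ea ?eb delta_hmat.
move=> p Qp; have [l [l0 /hmatP[l1 <-] lJ]] := genJ p Qp.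
have [i0 i0J] : exists i, i \in J.
  apply: contrapT => /forallNP J0.
  move: l1; rewrite big1 => [/eqP|i _]; first by rewrite eq_sym oner_eq0.
  by apply: lJ; apply/negP.
exists k, (l 0), (fun i => if i \in J then x i else x i0); split=> //.
  by move=> i; case: ifP => ?; apply: vJ.
by apply: eq_bigr => i _; case: ifPn => // /lJ ->; rewrite !scale0r.
Qed.

End Extreme.

(** * Bases of rows and lower bases *)

Section Bases.
Variables (R : realType) (N m : nat) (H : 'M[R]_(N, m)).
Implicit Types (s : {ffun 'I_m -> 'I_N}) (J : {set 'I_N}) (om : 'cV[R]_N).

Definition basis s : bool := rowsub s H \in unitmx.

Definition coords s (h : 'rV[R]_m) : 'rV[R]_m := h *m invmx (rowsub s H).

Definition swap s i j : {ffun 'I_m -> 'I_N} := [ffun k => if k == i then j else s k].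

Definition indep J : Prop :=
  forall mu : 'rV[R]_N, (forall j, j \notin J -> mu 0 j = 0) -> mu *m H = 0 -> mu = 0.

Definition spread s (a : 'rV[R]_m) : 'rV[R]_N := \row_j \sum_(i | s i == j) a 0 i.

Lemma spread_sum (V : lmodType R) s a (F : 'I_N -> V) :
  \sum_j spread s a 0 j *: F j = \sum_i a 0 i *: F (s i).
Proof.
rewrite [RHS](partition_big s xpredT) //=.
by apply: eq_bigr => j _; rewrite mxE scaler_suml; apply: eq_bigr => i /eqP <-.
Qed.

Lemma spreadE k s a (X : 'M[R]_(N, k)) : spread s a *m X = a *m rowsub s X.
Proof.
rewrite !mulmx_sum_row spread_sum; apply: eq_bigr => i _; congr (_ *: _).
by apply/rowP => l; rewrite !mxE.
Qed.

Lemma spread_out s a j : j \notin codom s -> spread s a 0 j = 0.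
Proof.
move=> js; rewrite mxE big_pred0 // => i; apply/negbTE; apply: contra js => /eqP <-.
exact: codom_f.
Qed.

Lemma coordsK s h : basis s -> coords s h *m rowsub s H = h.
Proof. by move=> bs; rewrite /coords mulmxKV. Qed.

Lemma coords_basis s i : basis s -> coords s (row (s i) H) = delta_mx 0 i.
Proof.
move=> bs; apply: (can_inj (mulmxK bs)); rewrite coordsK // -rowE.
by apply/rowP => k; rewrite !mxE.
Qed.

Lemma basis_inj s : basis s -> injective s.
Proof.
move=> bs i k E; have := coords_basis i bs; rewrite E coords_basis // => /matrixP.
by move=> /(_ 0 k); rewrite !mxE !eqxx /=; case: eqVneq => // _ /eqP; rewrite oner_eq0.
Qed.

Lemma spread_in s a i : basis s -> spread s a 0 (s i) = a 0 i.
Proof.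
move=> bs; rewrite mxE (big_pred1 i) // => k.
by rewrite (inj_eq (basis_inj bs)).
Qed.

Lemma spread_supported s (mu : 'rV[R]_N) : basis s ->
  (forall j, j \notin codom s -> mu 0 j = 0) ->
  mu = spread s (\row_i mu 0 (s i)).
Proof.
move=> bs muJ; apply/rowP => j; case: (boolP (j \in codom s)) => js; last first.
  by rewrite muJ // spread_out.
by have /codomP[i ->] := js; rewrite spread_in // mxE.
Qed.

Lemma basis_indep s : basis s -> indep [set j in codom s]%SET.
Proof.
move=> bs mu muJ.
have /(spread_supported bs) -> : forall j, j \notin codom s -> mu 0 j = 0.
  by move=> j js; apply: muJ; rewrite inE.
rewrite spreadE => /(canRL (mulmxK bs)); rewrite mul0mx => ->.
by apply/rowP => j; rewrite !mxE big1 // => i _; rewrite mxE.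
Qed.

(** If row j has a nonzero coordinate along the i-th basis row, it can replace
    that row: the new rows are obtained from the old ones by an elementary matrix
    with this coordinate on the diagonal. *)
Lemma swap_basis s i j :
  basis s -> coords s (row j H) 0 i != 0 -> basis (swap s i j).
Proof.
move=> bs; have := coordsK (row j H) bs; set c := coords _ _ => cH ci.
clearbody c; rewrite /basis -row_free_unit.
apply: inj_row_free => u.
have -> : u *m rowsub (swap s i j) H = (u - u 0 i *: (delta_mx 0 i - c)) *m rowsub s H.
  rewrite mulmxBl -scalemxAl mulmxBl cH -rowE !mulmx_sum_row.
  rewrite (bigD1 i) //= [in RHS](bigD1 i) //=.
  have -> : row i (rowsub (swap s i j) H) = row j H.
    by apply/rowP => k; rewrite !mxE ffunE eqxx.
  under eq_bigr => k ki.
    have -> : row k (rowsub (swap s i j) H) = row k (rowsub s H).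
      by apply/rowP => l; rewrite !mxE ffunE (negPf ki).
    over.
  by rewrite scalerBr opprB [RHS]addrC addrA subrK.
move=> /(canRL (mulmxK bs)); rewrite mul0mx => E.
have ui : u 0 i = 0.
  have /matrixP/(_ 0 i) := E; rewrite !mxE !eqxx mulrBr mulr1 opprB addrCA subrr addr0.
  by move=> /eqP; rewrite mulf_eq0 (negPf ci) orbF => /eqP.
by move: E; rewrite ui scale0r subr0.
Qed.

(** Steinitz exchange: take a basis meeting J in as many rows as possible. *)
Lemma extend_basis J : row_full H -> indep J ->
  exists2 s, basis s & {subset J <= codom s}.
Proof.
move=> fullH indJ.
have [s0 bs0] : exists s, basis s.
  exists (finfun (fullrankfun fullH)); rewrite /basis -row_full_unit.
  have -> : rowsub (finfun (fullrankfun fullH)) H = rowsub (fullrankfun fullH) H.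
    by apply/matrixP => i k; rewrite !mxE ffunE.
  by have := fullrowsub_unit fullH; rewrite -row_full_unit.
pose meet s := #|J :&: [set j in codom s]%SET|.
case: (arg_maxnP (P := basis) meet bs0) => s bs smax.
exists s => // j jJ; apply: contraT => js.
have [i ci iJ] : exists2 i, coords s (row j H) 0 i != 0 & s i \notin J.
  apply: contrapT => noi.
  pose mu := delta_mx 0 j - spread s (coords s (row j H)).
  suff : mu = 0.
    move=> /matrixP/(_ 0 j); rewrite !mxE !eqxx /= big_pred0 ?subr0.
      by move=> /eqP; rewrite oner_eq0.
    move=> i; apply/negbTE; apply: contra js => /eqP <-; exact: codom_f.
  apply: indJ => [k kJ|]; last first.
    by rewrite mulmxBl spreadE coordsK // -rowE subrr.
  rewrite !mxE eqxx /=; case: eqVneq => [kj|_]; first by rewrite -kj (negPf kJ) in jJ.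
  rewrite big1 ?subr0 // => i /eqP si; apply: contrapT => /eqP ci.
  by apply: noi; exists i => //; rewrite si.
have {smax} := smax _ (swap_basis bs ci); rewrite /geq /= leqNgt => /negP[].
apply: proper_card; apply/properP; split.
  apply/fintype.subsetP => k; rewrite !inE => /andP[kJ /codomP[l kl]].
  rewrite kJ /=; apply/codomP; exists l; rewrite ffunE.
  by case: eqVneq => // li; rewrite kl li (negPf iJ) in kJ.
exists j; last by rewrite !inE negb_and js orbT.
by rewrite !inE jJ; apply/codomP; exists i; rewrite ffunE eqxx.
Qed.

(** The numbers 1, ..., size p are too many to be all roots. *)
Lemma pos_nonroot (p : {poly R}) : p != 0 -> exists2 t, 0 < t & ~~ root p t.
Proof.
move=> p0; apply: contrapT => nt.
pose rs := [seq k.+1%:R : R | k <- iota 0 (size p)].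
have : (size rs < size p)%N.
  apply: max_poly_roots => //.
    apply/allP => _ /mapP[k _ ->]; apply: contrapT => /negP kr.
    by apply: nt; exists k.+1%:R; rewrite ?ltr0n.
  rewrite map_inj_uniq ?iota_uniq // => a b /eqP.
  by rewrite eqr_nat eqSS => /eqP.
by rewrite size_map size_iota ltnn.
Qed.

(** The affine function interpolating the heights om on the points of s. *)
Definition interp om s : 'cV[R]_m := invmx (rowsub s H) *m rowsub s om.

(** When the rows are homogeneous coordinates of points, the lower bases are the
    maximal simplices on the lower boundary of the hull of the points lifted to the
    heights om. *)
Definition lower om s : bool :=
  basis s && [forall j, (H *m interp om s) j 0 <= om j 0].

Definition generic om : Prop :=
  forall s j, basis s -> (H *m interp om s) j 0 = om j 0 -> j \in codom s.

Lemma interpE om s i : basis s -> (H *m interp om s) (s i) 0 = om (s i) 0.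
Proof.
move=> bs; have /matrixP/(_ i 0) : rowsub s H *m interp om s = rowsub s om.
  by rewrite mulKVmx.
by rewrite [RHS]mxE mul_rowsub_mx [LHS]mxE.
Qed.

(** Heights t ^ k off the basis s0 and 0 on it.  Height function and interpolation
    agree at a foreign row j only if t is a root of a polynomial whose
    coefficients are the entries, off s0, of the relation expressing row j through
    s; these entries are not all zero since the rows of s0 are independent.  So
    all but finitely many t are generic. *)
Lemma heightsP s0 : basis s0 ->
  exists2 om, generic om & lower om s0.
Proof.
move=> bs0.
(* The relation expressing row j through the basis s. *)
pose rel (sj : {ffun 'I_m -> 'I_N} * 'I_N) : 'rV[R]_N :=
  delta_mx 0 sj.2 - spread sj.1 (coords sj.1 (row sj.2 H)).
pose pol sj : {poly R} :=
  \sum_(k < N | k \notin codom s0) rel sj 0 k *: 'X^k.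
pose bad := [pred sj : {ffun 'I_m -> 'I_N} * 'I_N | basis sj.1 && (sj.2 \notin codom sj.1)].
have pol0 sj : bad sj -> pol sj != 0.
  case: sj => s j /andP[/= bs js]; apply/negP => /eqP p0.
  suff : rel (s, j) = 0.
    move=> /matrixP/(_ 0 j); rewrite mxE [X in X + _ = _]mxE !eqxx /= mxE.
    by rewrite spread_out // subr0 mxE => /eqP; rewrite oner_eq0.
  apply: (basis_indep bs0) => [k|]; last first.
    by rewrite mulmxBl spreadE coordsK // -rowE subrr.
  rewrite inE => ks; have := congr1 (fun p : {poly R} => p`_k) p0.
  rewrite coef0 coef_sum (bigD1 k) //= coefZ coefXn eqxx mulr1 big1 ?addr0 //.
  move=> l /andP[_ lk]; rewrite coefZ coefXn.
  by rewrite eq_sym (inj_eq val_inj) (negPf lk) mulr0.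
have [t t0 prodt] : exists2 t, 0 < t & ~~ root (\prod_(sj | bad sj) pol sj) t.
  apply: pos_nonroot; apply/prodf_neq0 => sj; exact: pol0.
have tr sj : bad sj -> ~~ root (pol sj) t.
  by move=> bsj; move: prodt; rewrite (bigD1 sj) //= rootM negb_or => /andP[].
pose om : 'cV[R]_N := \col_k (if k \in codom s0 then 0 else t ^+ k).
have om0 i : om (s0 i) 0 = 0 by rewrite mxE codom_f.
exists om; last first.
  rewrite /lower bs0 /=; apply/forallP => j.
  have -> : interp om s0 = 0.
    rewrite /interp; have -> : rowsub s0 om = 0.
      by apply/colP => i; rewrite mxE om0 mxE.
    by rewrite mulmx0.
  by rewrite mulmx0 [om]lock !mxE -lock mxE; case: ifP => // _; rewrite exprn_ge0 // ltW.
move=> s j bs E; apply: contraT => js.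
have /negP[] : ~~ root (pol (s, j)) t by apply: tr; rewrite /= bs.
rewrite /root.
have -> : (pol (s, j)).[t] = (rel (s, j) *m om) 0 0.
  rewrite horner_sum [RHS]mxE big_mkcond /=; apply: eq_bigr => k _.
  rewrite [om k 0]mxE; case: (boolP (k \in codom s0)) => ks /=.
    by rewrite mulr0.
  by rewrite hornerZ hornerXn.
rewrite mulmxBl mxE [X in _ + X]mxE -rowE.
have -> : spread s (coords s (row j H)) *m om = row j H *m interp om s.
  by rewrite spreadE /interp mulmxA.
by rewrite -row_mul mxE [X in _ - X]mxE E subrr.
Qed.

(** Dual simplex method: among the lower bases take the one whose affine function
    is largest at the given point; a negative coordinate there would allow a
    pivot to a lower basis with a strictly larger value. Genericity makes the
    step length positive. *)
Lemma lower_cover om s0 (l : 'rV[R]_N) :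
  generic om -> lower om s0 -> (forall j, 0 <= l 0 j) ->
  exists2 s, lower om s & forall i, 0 <= coords s (l *m H) 0 i.
Proof.
move=> gen low0 l0.
pose val s := (l *m H *m interp om s) 0 0.
case: (arg_maxP (P := lower om) val low0) => s lows smax.
exists s => // i; rewrite leNgt; apply/negP => neg.
have /andP[bs /forallP le_om] := lows.
pose d : 'cV[R]_m := - (invmx (rowsub s H) *m delta_mx i 0).
pose slope j := - coords s (row j H) 0 i.
have colE k (B : 'M[R]_(k, m)) j : (B *m delta_mx i (0 : 'I_1)) j 0 = B j i.
  by rewrite -colE mxE.
have HdE j : (H *m d) j 0 = slope j.
  by rewrite mulmxN mulmxA mxE colE /slope /coords -row_mul [in RHS]mxE.
have ldE : (l *m H *m d) 0 0 = - coords s (l *m H) 0 i.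
  by rewrite mulmxN mulmxA mxE colE.
have slope_s k : slope (s k) = - (k == i)%:R.
  by rewrite /slope coords_basis // mxE eqxx eq_sym.
have [j0 j0P] : exists j, 0 < slope j.
  apply: contrapT => /forallNP nj.
  have : (l *m H *m d) 0 0 <= 0.
    rewrite -mulmxA mxE; apply: sumr_le0 => j _.
    by rewrite HdE mulr_ge0_le0 // leNgt; apply/negP.
  by rewrite ldE oppr_le0 leNgt neg.
pose slack j := om j 0 - (H *m interp om s) j 0.
have slack0 j : 0 <= slack j by rewrite subr_ge0.
(* Tilt the affine function along d until it first meets a height. *)
case: (arg_minP (P := fun j => 0 < slope j) (fun j => slack j / slope j) j0P).
move=> j jP jmin; set e := slack j / slope j in jmin.
have js : j \notin codom s.
  by apply/codomP => -[k jk]; move: jP; rewrite jk slope_s oppr_gt0 ltNge ler0n.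
have e0 : 0 < e.
  rewrite divr_gt0 // lt_neqAle slack0 andbT eq_sym subr_eq0 eq_sym.
  by apply: contra js => /eqP /(gen s j bs).
have bs' : basis (swap s i j).
  by apply: swap_basis => //; move: jP; rewrite oppr_gt0; apply: ltr0_neq0.
have itE : interp om (swap s i j) = interp om s + e *: d.
  apply: (can_inj (mulKmx bs')); rewrite mulKVmx // mul_rowsub_mx mulmxDr -scalemxAr.
  apply/colP => k; rewrite mxE [RHS]mxE [RHS]mxE [X in _ + X]mxE HdE ffunE.
  case: eqVneq => [_|ki].
    by rewrite divfK ?gt_eqF // addrC subrK.
  by rewrite interpE // slope_s (negPf ki) oppr0 mulr0 addr0.
have low' : lower om (swap s i j).
  rewrite /lower bs' /=; apply/forallP => k.
  rewrite itE mulmxDr -scalemxAr mxE [X in _ + X]mxE HdE -lerBrDl.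
  have [sk|sk] := ltP 0 (slope k); last first.
    by apply: le_trans (slack0 k); rewrite pmulr_rle0.
  by rewrite -ler_pdivlMr //; apply: jmin.
have := smax _ low'; rewrite /= /val itE mulmxDr -scalemxAr mxE [X in _ + X]mxE ldE.
by rewrite gerDl pmulr_rle0 // oppr_le0 leNgt neg.
Qed.

(** Both affine functions agree with the heights on their own simplex and stay
    below them elsewhere; at a common point they must coincide, and every point
    of s' carrying weight is then tight for s. *)
Lemma lower_meet om s s' h : generic om -> lower om s -> lower om s' ->
  (forall i, 0 <= coords s h 0 i) -> (forall i, 0 <= coords s' h 0 i) ->
  forall i, coords s' h 0 i != 0 -> s' i \in codom s.
Proof.
move=> gen; move: s s'.
have gap s s' : lower om s -> lower om s' ->
    \sum_i coords s' h 0 i * (om (s' i) 0 - (H *m interp om s) (s' i) 0) =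
    (h *m interp om s') 0 0 - (h *m interp om s) 0 0.
  move=> /andP[bs _] /andP[bs' _].
  have -> : h *m interp om s' = coords s' h *m rowsub s' om by rewrite mulmxA.
  have -> : h *m interp om s = coords s' h *m rowsub s' (H *m interp om s).
    by rewrite -mul_rowsub_mx mulmxA coordsK.
  rewrite [X in _ = X - _]mxE [X in _ = _ - X]mxE -sumrB.
  by apply: eq_bigr => i _; rewrite mulrBr; congr (_ * _ - _ * _); rewrite [RHS]mxE.
have gap0 s s' : lower om s -> lower om s' ->
    (forall i, 0 <= coords s' h 0 i) -> forall i,
    0 <= coords s' h 0 i * (om (s' i) 0 - (H *m interp om s) (s' i) 0).
  by move=> /andP[_ /forallP le] _ p0 i; rewrite mulr_ge0 // subr_ge0.
move=> s s' ls ls' p p' i ci; have /andP[bs _] := ls.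
apply: (gen s) => //.
have /eqP : \sum_i coords s' h 0 i * (om (s' i) 0 - (H *m interp om s) (s' i) 0) = 0.
  apply/eqP; rewrite eq_le sumr_ge0 ?andbT => [|k _]; last exact: gap0.
  rewrite gap // subr_le0 -subr_ge0 -gap // sumr_ge0 // => k _; exact: gap0.
rewrite psumr_eq0 => [/allP/(_ i)|k _]; last exact: gap0.
rewrite mem_index_enum => /(_ isT) /=.
by rewrite mulf_eq0 (negPf ci) subr_eq0 /= => /eqP.
Qed.

End Bases.

(** * Reduction to independent supports *)

Section SupportInduction.
Variables (R : realType) (N m : nat) (H : 'M[R]_(N, m)).

Definition support (l : 'rV[R]_N) : {set 'I_N} := [set j | l 0 j != 0]%SET.

(** The weights are moved along the relation until the first of them vanishes:
    t is the least ratio of a weight to the rate at which it decreases. *)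
Lemma shrink_support (l mu : 'rV[R]_N) :
  (forall j, 0 <= l 0 j) -> (forall j, j \notin support l -> mu 0 j = 0) ->
  (exists j, mu 0 j < 0) ->
  exists t, [/\ 0 < t, forall j, 0 <= (l + t *: mu) 0 j
    & (#|support (l + t *: mu)| < #|support l|)%N].
Proof.
move=> l0 muS [j0 j0P].
case: (arg_minP (P := fun j => mu 0 j < 0) (fun j => l 0 j / - mu 0 j) j0P).
move=> j jP jmin; set t := l 0 j / - mu 0 j in jmin.
have jS : j \in support l.
  by apply: contraT => /muS mu0; move: jP; rewrite mu0 ltxx.
have t0 : 0 < t.
  rewrite divr_gt0 ?oppr_gt0 // lt_neqAle l0 andbT eq_sym.
  by move: jS; rewrite inE.
exists t; split=> // [k|].
  rewrite !mxE; have [muk|muk] := ltP (mu 0 k) 0.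
    by have := jmin _ muk; rewrite ler_pdivlMr ?oppr_gt0 // mulrN -subr_ge0 opprK.
  by rewrite addr_ge0 // mulr_ge0 // ltW.
apply: proper_card; apply/properP; split.
  apply/fintype.subsetP => k; rewrite !inE !mxE; apply: contra => /eqP lk.
  by rewrite lk add0r muS ?mulr0 // inE lk eqxx.
exists j => //; rewrite !inE !mxE negbK /t invrN mulrN mulNr divfK ?subrr //.
by rewrite lt_eqF.
Qed.

(** The weights representing a given point form a polytope whose extreme points
    have independent support; this is the induction principle expressing that
    each of its points is a convex combination of extreme ones. *)
Lemma indep_support_ind (h : 'rV[R]_m) (P : 'rV[R]_N -> Prop) :
  (forall mu : 'rV[R]_N, mu *m H = 0 -> \sum_j mu 0 j = 0) ->
  (forall a b (t : R), 0 < t < 1 -> P a -> P b -> P (t *: a + (1 - t) *: b)) ->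
  (forall l : 'rV[R]_N, (forall j, 0 <= l 0 j) -> l *m H = h ->
    indep H (support l) -> P l) ->
  forall l : 'rV[R]_N, (forall j, 0 <= l 0 j) -> l *m H = h -> P l.
Proof.
move=> H1 Pconv Pindep l; have [c] := ubnP #|support l|.
elim: c l => // c IH l lc l0 lh.
have [|] := pselect (indep H (support l)); first exact: Pindep.
move=> /existsNP[mu /not_implyP[muS /not_implyP[muH mu0]]].
have mu_neg (nu : 'rV[R]_N) : nu *m H = 0 -> nu <> 0 -> exists j, nu 0 j < 0.
  move=> nuH nu0; apply: contrapT => /forallNP nge; apply: nu0.
  have nge0 j : 0 <= nu 0 j by rewrite leNgt; apply/negP.
  apply/rowP => j; rewrite mxE; have /eqP := H1 _ nuH.
  by rewrite psumr_eq0 // => /allP/(_ j); rewrite mem_index_enum => /(_ isT)/eqP.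
have [t [t0 tge tc]] := shrink_support l0 muS (mu_neg _ muH mu0).
have muSN j : j \notin support l -> (- mu) 0 j = 0.
  by move=> jl; rewrite mxE muS // oppr0.
have muHN : - mu *m H = 0 by rewrite mulNmx muH oppr0.
have [|u [u0 uge uc]] := shrink_support l0 muSN (mu_neg _ muHN _).
  by move=> /eqP; rewrite oppr_eq0 => /eqP.
have tu0 : t + u != 0 by rewrite gt_eqF // addr_gt0.
(* l lies between the two shrunk weight vectors l + t mu and l - u mu. *)
have -> : l = (u / (t + u)) *: (l + t *: mu) + (1 - u / (t + u)) *: (l + u *: - mu).
  have -> : 1 - u / (t + u) = t / (t + u).
    by rewrite -{1}(divff tu0) -mulrBl addrK.
  rewrite scalerN !scalerDr scalerN !scalerA addrACA -scalerDl -mulrDl (addrC u).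
  by rewrite divff // scale1r mulrAC (mulrAC t) (mulrC u) subrr addr0.
apply: Pconv.
- rewrite divr_gt0 ?addr_gt0 //= ltr_pdivrMr ?addr_gt0 // mul1r.
  by rewrite ltrDr.
- apply: IH => //; first exact: leq_trans tc _.
  by rewrite mulmxDl -scalemxAl muH scaler0 addr0.
- apply: IH => //; first exact: leq_trans uc _.
  by rewrite mulmxDl -scalemxAl muHN scaler0 addr0.
Qed.

End SupportInduction.

(** * The minimum principle for midpoints *)

Section Midpoints.
Variables (R : realType) (n : nat).

Definition sqnorm (u : 'X_{1..n}) : nat := (\sum_i u i ^ 2)%N.

(** Parallelogram law; the boolean makes it strict when a and b differ. *)
Lemma sqr_midpoint (a b u : nat) : (a + b = u + u)%N ->
  (2 * u ^ 2 + (a != b) <= a ^ 2 + b ^ 2)%N.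
Proof.
wlog ab : a b / (a <= b)%N => [W E|E].
  have [/W|/ltnW/W] := leqP a b; first exact.
  by rewrite eq_sym [X in (_ <= X)%N]addnC; apply; rewrite addnC.
have [d uE bE] : exists2 d, u = (a + d)%N & b = (a + 2 * d)%N.
  by exists (u - a)%N; lia.
have -> : (a != b) = (d != 0)%N by rewrite bE; lia.
rewrite uE bE; case: d {uE bE} => [|d] /=; rewrite -!mulnn; nia.
Qed.

Lemma sqnorm_midpoint (a b u : 'X_{1..n}) : (a + b = u + u)%MM -> a <> b ->
  (2 * sqnorm u < sqnorm a + sqnorm b)%N.
Proof.
move=> /mnmP abE ab.
have [i abi] : exists i, a i <> b i.
  by apply: contrapT => /forallNP E; apply: ab; apply/mnmP => i; apply: contrapT.
have E j : (a j + b j = u j + u j)%N by have := abE j; rewrite !mnmDE.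
rewrite /sqnorm big_distrr -big_split /= (bigD1 i) //= [X in (_ < X)%N](bigD1 i) //=.
rewrite -addSn leq_add //.
  by have := sqr_midpoint (E i); move/eqP: abi => ->; rewrite addn1.
apply: leq_sum => j _; apply: leq_trans (sqr_midpoint (E j)); exact: leq_addr.
Qed.

(** Minimum principle: at a point of largest norm among the minimisers, strict
    convexity of the squared norm forbids being the midpoint of two other
    minimisers. *)
Lemma midpoint_min (s : seq 'X_{1..n}) (x : 'X_{1..n} -> R) :
  (forall u, u \in s -> 0 <= x u \/ exists a b,
    [/\ a \in s, b \in s, a <> b, (a + b = u + u)%MM & x a + x b <= x u + x u]) ->
  forall u, u \in s -> 0 <= x u.
Proof.
move=> mid u us; rewrite leNgt; apply/negP => xu.
pose z (v : seq_sub s) := x (ssval v).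
case: (arg_minP (P := xpredT) z (i0 := SeqSub us) isT) => u1 _ min1.
have [u2 /eqP x2 max2] : exists2 u2, z u2 == z u1 &
    forall v, z v == z u1 -> (sqnorm (ssval v) <= sqnorm (ssval u2))%N.
  by case: (arg_maxnP (P := fun v => z v == z u1) (fun v => sqnorm (ssval v))
    (eqxx (z u1))) => u2 ? ?; exists u2.
have neg2 : x (ssval u2) < 0 by rewrite -/(z u2) x2; apply: le_lt_trans (min1 (SeqSub us) _) xu.
have [|[a [b [as_ bs ab abE xab]]]] := mid _ (ssvalP u2); first by rewrite leNgt neg2.
have min_a := min1 (SeqSub as_) isT; have min_b := min1 (SeqSub bs) isT.
rewrite -/(z u2) x2 in xab.
rewrite -[x a]/(z (SeqSub as_)) -[x b]/(z (SeqSub bs)) in xab.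
have za : z (SeqSub as_) == z u1 by rewrite eq_le min_a andbT; lra.
have zb : z (SeqSub bs) == z u1 by rewrite eq_le min_b andbT; lra.
have := sqnorm_midpoint abE ab; have /= := max2 _ za; have /= := max2 _ zb.
lia.
Qed.

End Midpoints.

(** If A satisfies the minimum principle then 1 - A is an M-matrix: it is
    invertible with nonnegative inverse, and a row of the inverse solves the
    system f = A f + h for one unknown. *)
Lemma nonneg_inverse (R : realType) (T : finType) (A : T -> T -> R) :
  (forall x : T -> R, (forall u, \sum_v A u v * x v <= x u) -> forall u, 0 <= x u) ->
  forall y, exists g : T -> R, (forall u, 0 <= g u) /\
    forall (V : lmodType R) (f : T -> V),
      f y = \sum_u g u *: (f u - \sum_v A u v *: f v).
Proof.
move=> minA y.
pose M : 'M[R]_#|T| := \matrix_(i, j) ((i == j)%:R - A (enum_val i) (enum_val j)).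
have sumM (V : lmodType R) (f : T -> V) i :
    \sum_j M i j *: f (enum_val j) = f (enum_val i) - \sum_v A (enum_val i) v *: f v.
  under eq_bigr do rewrite mxE scalerBl.
  rewrite sumrB (bigD1 i) //= eqxx scale1r big1 ?addr0 => [|j ji].
    by congr (_ - _); rewrite [RHS](reindex (fun i : 'I_#|T| => enum_val i)) //; apply: onW_bij; apply: enum_val_bij.
  by rewrite eq_sym (negPf ji) scale0r.
have minM (x : 'cV[R]_#|T|) : (forall i, 0 <= (M *m x) i 0) -> forall i, 0 <= x i 0.
  move=> Mx i; rewrite -[i]enum_valK.
  apply: (minA (fun u => x (enum_rank u) 0)) => u.
  have E : \sum_j M (enum_rank u) j * x (enum_rank (enum_val j)) 0 =
      x (enum_rank u) 0 - \sum_v A u v * x (enum_rank v) 0.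
    by have := sumM R^o (fun v => x (enum_rank v) 0) (enum_rank u); rewrite enum_rankK.
  rewrite -subr_ge0 -E; apply: le_trans (Mx (enum_rank u)) _; rewrite mxE.
  by apply: ler_sum => j _; rewrite enum_valK.
have uM : M \in unitmx.
  rewrite -unitmx_tr -row_free_unit; apply: inj_row_free => v vM.
  have MvT : M *m v^T = 0 by apply: trmx_inj; rewrite trmx_mul trmxK vM trmx0.
  apply/rowP => i; rewrite mxE; apply/eqP; rewrite eq_le.
  have := minM v^T; rewrite MvT => /(_ _ i); rewrite [v^T _ _]mxE => -> ; last first.
    by move=> j; rewrite mxE.
  have := minM (- v^T); rewrite mulmxN MvT oppr0 => /(_ _ i).
  rewrite mxE [v^T _ _]mxE oppr_ge0 => -> // j; by rewrite mxE.
exists (fun u => invmx M (enum_rank y) (enum_rank u)); split=> [u|V f].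
  have := minM (invmx M *m delta_mx (enum_rank u) 0); rewrite mulKVmx //.
  move=> /(_ _ (enum_rank y)); rewrite -colE [col _ _ _ _]mxE; apply=> i.
  by rewrite mxE ler0n.
rewrite (reindex (fun i : 'I_#|T| => enum_val i)) /=; last by apply: onW_bij; apply: enum_val_bij.
under eq_bigr => i _ do rewrite enum_valK -sumM scaler_sumr.
rewrite exchange_big /=.
have E j : \sum_i invmx M (enum_rank y) i *: (M i j *: f (enum_val j)) =
    (1%:M : 'M[R]_#|T|) (enum_rank y) j *: f (enum_val j).
  rewrite -(mulVmx uM) [in RHS]mxE scaler_suml; apply: eq_bigr => i _.
  by rewrite scalerA.
under eq_bigr do rewrite E.
rewrite (bigD1 (enum_rank y)) //= mxE eqxx scale1r enum_rankK big1 ?addr0 // => j ji.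
by rewrite mxE eq_sym (negPf ji) scale0r.
Qed.

(** * Lattice points and sums of squares *)

Section LatticePoints.
Variables (R : realType) (n : nat).
Implicit Types (a b m u : 'X_{1..n}).

Lemma zpoint_inj : injective (@zpoint R n).
Proof.
move=> u v /matrixP E; apply/rowP => i; have := E 0 i.
by rewrite !mxE => /intr_inj.
Qed.

Lemma mexponent_inj : injective (@mexponent n).
Proof.
by move=> a b /rowP E; apply/mnmP => i; have := E i; rewrite !mxE => -[].
Qed.

Lemma mpoint_inj : injective (@mpoint R n).
Proof. by move=> a b /zpoint_inj/mexponent_inj. Qed.

Lemma mpointE m i : mpoint R m 0 i = (m i)%:R.
Proof. by rewrite !mxE. Qed.

Lemma mpointD a b : mpoint R (a + b)%MM = mpoint R a + mpoint R b.
Proof. by apply/rowP => i; rewrite mpointE mnmDE natrD mxE !mpointE. Qed.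

Lemma mexponentD a b : mexponent (a + b)%MM = mexponent a + mexponent b.
Proof. by apply/rowP => i; rewrite !mxE mnmDE PoszD. Qed.

Lemma double_even m : (forall i, ~~ odd (m i)) -> exists e, m = (e + e)%MM.
Proof.
move=> ev; exists [multinom (m i)./2 | i < n]; apply/mnmP => i.
by rewrite mnmDE mnmE addnn even_halfK.
Qed.

Lemma even_pointP m : even_point (mexponent m) <-> exists e, m = (e + e)%MM.
Proof.
split=> [ev|[e ->] i]; last by rewrite mxE mnmDE addnn -muln2 PoszM dvdz_mull.
by apply: double_even => i; have := ev i; rewrite mxE dvdzE /= dvdn2.
Qed.

Lemma hvec_midpoint (a b u : 'X_{1..n}) : (a + b = u + u)%MM ->
  hvec (mpoint R a) + hvec (mpoint R b) = hvec (mpoint R u) + hvec (mpoint R u).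
Proof.
move=> E; have := congr1 (mpoint R) E; rewrite !mpointD => /rowP P.
apply/rowP => j; rewrite !mxE; case: unliftP => [i _|//] /=.
by have := P i; rewrite !mxE.
Qed.

End LatticePoints.

Section SumsOfSquares.
Variables (R : realType) (n : nat).
Implicit Types (p q : {mpoly R[n]}).

Lemma sos0 : sum_of_squares (0 : {mpoly R[n]}).
Proof. by exists [::]; rewrite big_nil. Qed.

Lemma sosD p q : sum_of_squares p -> sum_of_squares q -> sum_of_squares (p + q).
Proof. by move=> [s ->] [t ->]; exists (s ++ t); rewrite big_cat. Qed.

Lemma sosZ (c : R) p : 0 <= c -> sum_of_squares p -> sum_of_squares (c *: p).
Proof.
move=> c0 [s ->]; exists [seq Num.sqrt c *: q | q <- s].
rewrite big_map scaler_sumr; apply: eq_bigr => q _.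
by rewrite exprZn sqr_sqrtr.
Qed.

Lemma sos_sqr p : sum_of_squares (p ^+ 2).
Proof. by exists [:: p]; rewrite big_seq1. Qed.

Lemma sos_sum (I : finType) (F : I -> {mpoly R[n]}) :
  (forall i, sum_of_squares (F i)) -> sum_of_squares (\sum_i F i).
Proof.
by move=> sF; apply: (big_ind (@sum_of_squares R n)) => //; [exact: sos0|exact: sosD].
Qed.

(** A monomial whose coefficient in a sum of squares is too small must receive
    a mixed product of two distinct monomials of some summand, the diagonal
    products contributing nonnegatively. *)
Lemma sos_split (s : seq {mpoly R[n]}) m :
  (\sum_(q <- s) q ^+ 2)@_m <= 0 ->
  (\sum_(q <- s) q ^+ 2)@_m < 0 \/
    (exists q e, [/\ q \in s, e \in msupp q & m = (e + e)%MM]) ->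
  exists q a b, [/\ q \in s, a \in msupp q, b \in msupp q, a <> b & m = (a + b)%MM].
Proof.
move=> le0 hm; apply: contrapT => nosplit.
have diag q (k : 'X_{1..n < (mdeg m).+1, (mdeg m).+1}) : q \in s -> m == (k.1 + k.2)%MM ->
    q@_k.1 * q@_k.2 = if (k.1 : 'X_{1..n}) == k.2 then q@_k.1 ^+ 2 else 0.
  move=> qs /eqP mk; case: eqVneq => [->|/eqP k12]; first by rewrite expr2.
  apply: contrapT => /eqP; rewrite mulf_eq0 negb_or -!mcoeff_msupp => /andP[k1 k2].
  by apply: nosplit; exists q, (k.1 : 'X_{1..n}), (k.2 : 'X_{1..n}).
have sq_ge0 q : q \in s -> 0 <= (q ^+ 2)@_m.
  move=> qs; rewrite expr2 mcoeffM; apply: sumr_ge0 => k km.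
  by rewrite diag //; case: ifP => // _; rewrite sqr_ge0.
have sum0 : (\sum_(q <- s) q ^+ 2)@_m = 0.
  apply/eqP; rewrite eq_le le0 /= raddf_sum /= big_seq.
  by apply: sumr_ge0 => q; apply: sq_ge0.
case: hm => [|[q [e [qs eq me]]]]; first by rewrite sum0 ltxx.
have : (q ^+ 2)@_m = 0.
  have /eqP := sum0; rewrite raddf_sum /= big_seq psumr_eq0; last first.
    by move=> r; apply: sq_ge0.
  by move=> /allP/(_ q qs); rewrite qs => /eqP.
apply/eqP; rewrite gt_eqF // expr2 mcoeffM.
have em : (mdeg e < (mdeg m).+1)%N by rewrite ltnS me mdegD leq_addr.
rewrite (bigD1 (BMultinom em, BMultinom em)) /=; last by rewrite me.
rewrite ltr_pwDl //.
  by rewrite -expr2 exprn_even_gt0 //= -mcoeff_msupp.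
apply: sumr_ge0 => k /andP[km _].
by rewrite diag //; case: ifP => // _; rewrite sqr_ge0.
Qed.

End SumsOfSquares.

(** * Mediated sets and agiforms on a simplex *)

Section MediatedSimplex.
Variables (R : realType) (n : nat) (w : 'I_n.+1 -> 'X_{1..n}).
Hypothesis unit_w : hmat (fun i => mpoint R (w i)) \in unitmx.

Let S : set 'rV[R]_n := conv_hull (range (fun i => mpoint R (w i))).

Definition bary (m : 'X_{1..n}) : 'rV[R]_n.+1 :=
  hvec (mpoint R m) *m invmx (hmat (fun i => mpoint R (w i))).

Lemma bary_midpoint (a b u : 'X_{1..n}) : (a + b = u + u)%MM ->
  bary a + bary b = bary u + bary u.
Proof. by move=> /(hvec_midpoint R) E; rewrite -!mulmxDl E. Qed.

Lemma bary_vertex i : bary (w i) = delta_mx 0 i.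
Proof.
by apply: (can_inj (mulmxK unit_w)); rewrite mulmxKV // delta_hmat.
Qed.

Lemma bary_unique (l : 'rV[R]_n.+1) m :
  l *m hmat (fun i => mpoint R (w i)) = hvec (mpoint R m) -> l = bary m.
Proof. by rewrite /bary => <-; rewrite mulmxK. Qed.

Lemma simplexP m : S (mpoint R m) <-> forall i, 0 <= bary m 0 i.
Proof.
split=> [/conv_hull_rangeP[l [l0 /bary_unique <-]] //|b0].
by apply/conv_hull_rangeP; exists (bary m); rewrite mulmxKV.
Qed.

Lemma simplex_lattice_vertices (u : 'rV[int]_n) :
  lattice_vertices S u <-> exists i, u = mexponent (w i).
Proof.
rewrite /lattice_vertices /= /S simplex_vertices //.
by split=> [[i _ /zpoint_inj <-]|[i ->]]; [exists i|exists i].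
Qed.

Lemma simplex_monomial (u : 'rV[int]_n) : S (zpoint R u) -> exists m, u = mexponent m.
Proof.
move=> /conv_hull_rangeP[l [l0 /hmatP[_ lu]]].
exists [multinom `|u ord0 i|%N | i < n]; apply/rowP => i.
rewrite mxE mnmE gez0_abs // -(ler_int R).
have -> : (u 0 i)%:~R = zpoint R u 0 i by rewrite mxE.
rewrite -lu summxE sumr_ge0 // => j _.
by rewrite mxE mpointE mulr_ge0.
Qed.

(** The degree is an affine function, hence bounded on the simplex by its values
    at the vertices; this makes the lattice points of the simplex range over a
    finite type. *)
Lemma simplex_mdeg m : S (mpoint R m) -> (mdeg m <= \max_i mdeg (w i))%N.
Proof.
have degE (a : 'X_{1..n}) : (mdeg a)%:R = \sum_k mpoint R a 0 k.
  by rewrite mdegE natr_sum; apply: eq_bigr => k _; rewrite mpointE.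
move=> /conv_hull_rangeP[l [l0 /hmatP[l1 lu]]].
rewrite -(ler_nat R) degE -lu.
have -> : \sum_k (\sum_i l 0 i *: mpoint R (w i)) 0 k = \sum_i l 0 i * (mdeg (w i))%:R.
  under eq_bigr do rewrite summxE.
  rewrite exchange_big /=; apply: eq_bigr => i _; rewrite degE mulr_sumr.
  by apply: eq_bigr => k _; rewrite mxE.
rewrite -[leRHS]mul1r -[X in _ <= X * _]l1 mulr_suml; apply: ler_sum => i _.
apply: ler_wpM2l => //; rewrite ler_nat; exact: leq_bigmax.
Qed.

(** The exponents of the summands, doubled, form a mediated set together with
    the vertices and y: every non-vertex has a nonpositive coefficient, so it
    splits. The minimum principle applied to each barycentric coordinate keeps
    this set inside the simplex. *)
Lemma sos_mediated (g : {mpoly R[n]}) y :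
  sum_of_squares g ->
  (forall m, (forall i, m <> w i) -> g@_m <= 0) ->
  g@_y < 0 -> max_mediated S (mexponent y).
Proof.
move=> [s gE] g_le0 gy.
pose M := y :: [seq w i | i <- enum 'I_n.+1] ++
  flatten [seq [seq (e + e)%MM | e <- msupp q] | q <- s].
have inM q e : q \in s -> e \in msupp q -> (e + e)%MM \in M.
  move=> qs eq; rewrite inE mem_cat; apply/orP; right; apply/orP; right.
  by apply/flattenP; exists [seq (e + e)%MM | e <- msupp q];
    [apply: map_f|apply: map_f].
have wM i : w i \in M by rewrite inE mem_cat map_f ?orbT // mem_enum.
have splitM m : m \in M -> (exists i, m = w i) \/
    exists a b, [/\ (a + a)%MM \in M, (b + b)%MM \in M, a <> b & m = (a + b)%MM].
  move=> mM; have [|/forallNP mw] := pselect (exists i, m = w i); first by left.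
  right; have gm := g_le0 _ mw; rewrite gE in gm.
  have [|q [a [b [qs aq bq ab mE]]]] := sos_split gm; last first.
    by exists a, b; split=> //; apply: (inM q).
  move: mM; rewrite inE mem_cat => /orP[/eqP->|/orP[/mapP[i _ mi]|]].
  - by left; rewrite -gE.
  - by case: (mw i).
  - move=> /flattenP[_ /mapP[q qs ->] /mapP[e eq ->]].
    by right; exists q, e.
have double_neq (a b : 'X_{1..n}) : a <> b -> (a + a)%MM <> (b + b)%MM.
  move=> ab /mnmP E; apply: ab; apply/mnmP => i; have := E i.
  by rewrite !mnmDE; lia.
have dist2 (a b : 'X_{1..n}) : (a + a + (b + b) = (a + b) + (a + b))%MM.
  by apply/mnmP => i; rewrite !mnmDE; lia.
have in_S m : m \in M -> S (mpoint R m).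
  move=> mM; apply/simplexP => i.
  apply: (midpoint_min (x := fun u => bary u 0 i) _ mM) => u /splitM[[j ->]|].
    by left; rewrite bary_vertex mxE ler0n.
  move=> [a [b [aM bM ab ->]]]; right; exists (a + a)%MM, (b + b)%MM.
  split=> //; first exact: double_neq.
  have /rowP/(_ i) := bary_midpoint (dist2 a b).
  by rewrite mxE [RHS]mxE => ->.
exists (@mexponent n @` [set` M]); last by exists y => //=; rewrite inE eqxx.
split=> [_ [m /= mM <-]|u /simplex_lattice_vertices[i ->]|_ [m /= mM <-]].
- exact: in_S.
- by exists (w i) => //=.
- case: (splitM m mM) => [[i ->]|[a [b [aM bM ab ->]]]].
    by right; apply/simplex_lattice_vertices; exists i.
  left; exists (mexponent (a + a)%MM), (mexponent (b + b)%MM); split.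
  + by move=> /mexponent_inj; apply: double_neq.
  + by split; [exists (a + a)%MM|apply/even_pointP; exists a].
  + by split; [exists (b + b)%MM|apply/even_pointP; exists b].
  + by rewrite mulr2n -!mexponentD dist2.
Qed.

Definition simplex_agiform (m : 'X_{1..n}) : {mpoly R[n]} :=
  \sum_i bary m 0 i *: 'X_[w i] - 'X_[m].

Lemma simplex_agiform_vertex i : simplex_agiform (w i) = 0.
Proof.
rewrite /simplex_agiform bary_vertex (bigD1 i) //= mxE !eqxx scale1r big1 ?addr0 ?subrr //.
by move=> j ji; rewrite mxE (negPf ji) andbF scale0r.
Qed.

(** Barycentric coordinates are affine, so the vertex terms cancel and the
    identity reduces to completing the square for two monomials. *)
Lemma simplex_agiform_midpoint (a b : 'X_{1..n}) :
  simplex_agiform (a + b)%MM =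
  2^-1 *: simplex_agiform (a + a)%MM + 2^-1 *: simplex_agiform (b + b)%MM +
  2^-1 *: ('X_[a] - 'X_[b]) ^+ 2.
Proof.
have ab : (a + a + (b + b) = (a + b) + (a + b))%MM.
  by apply/mnmP => i; rewrite !mnmDE; lia.
have half i : bary (a + b)%MM 0 i =
    2^-1 * bary (a + a)%MM 0 i + 2^-1 * bary (b + b)%MM 0 i.
  have /rowP/(_ i) := bary_midpoint ab; rewrite mxE [RHS]mxE; lra.
rewrite /simplex_agiform; under eq_bigr do rewrite half scalerDl -!scalerA.
rewrite big_split -!scaler_sumr /= !mpolyXD.
have : (2^-1)%:MP + (2^-1)%:MP = 1 :> {mpoly R[n]}.
  by rewrite -mpolyCD -[X in (X + X)%:MP]mul1r -splitr mpolyC1.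
rewrite -!mul_mpolyC; move: (2^-1)%:MP => h h1.
by rewrite -['X_[a] * 'X_[b]]mul1r -h1; ring.
Qed.

(** Every non-vertex u of the mediated set satisfies
    f_u = (f_a + f_b) / 2 + (a square) / 2; the minimum principle makes this
    linear system invertible with nonnegative inverse, so f_y is a nonnegative
    combination of the squares. *)
Lemma mediated_sos L y : mediated S L -> L (mexponent y) ->
  sum_of_squares (simplex_agiform y).
Proof.
move=> [LS _ Lmid] Ly.
have LSm m : L (mexponent m) -> S (mpoint R m) by move=> /LS.
pose d := (\max_i mdeg (w i)).+1; pose T := 'X_{1..n < d}.
have Ldeg m : L (mexponent m) -> (mdeg m < d)%N.
  by move=> /LSm/simplex_mdeg; rewrite ltnS.
(* The non-vertices of L, the unknowns of the system; outside them F and A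
   vanish, which lets the index type be all exponents of degree below d. *)
pose inner (u : 'X_{1..n}) := `[< L (mexponent u) /\ ~ exists i, u = w i >].
have /choice[c cP] (u : T) : exists c : 'X_{1..n} * 'X_{1..n}, inner u ->
    [/\ c.1 <> c.2, L (mexponent (c.1 + c.1)%MM), L (mexponent (c.2 + c.2)%MM)
      & u = (c.1 + c.2)%MM :> 'X_{1..n}].
  have [/asboolP[Lu uw]|] := boolP (inner u); last by exists (u : 'X_{1..n}, u : 'X_{1..n}).
  case: (Lmid _ Lu) => [[p [q [pq [Lp ep] [Lq eq] pqE]]]|]; last first.
    move=> /simplex_lattice_vertices[i /mexponent_inj ui].
    by case: uw; exists i.
  have [a pE] := simplex_monomial (LS _ Lp); have [b qE] := simplex_monomial (LS _ Lq).
  move: pq Lp ep Lq eq pqE; rewrite {}pE {}qE => pq Lp /even_pointP[a' aE].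
  move=> Lq /even_pointP[b' bE]; rewrite mulr2n -!mexponentD => /mexponent_inj/mnmP uE.
  exists (a', b'); rewrite /= -aE -bE; split=> // [ab|].
    by apply: pq; rewrite aE bE ab.
  by apply/mnmP => i; have := uE i; rewrite aE bE !mnmDE; lia.
pose F (u : 'X_{1..n}) := if inner u then simplex_agiform u else 0.
have FE u : L (mexponent u) -> F u = simplex_agiform u.
  rewrite /F /inner => Lu; case: asboolP => // /not_andP[//|/contrapT[i ->]].
  by rewrite simplex_agiform_vertex.
pose A (u v : T) : R := if inner u then
  2^-1 * ((v : 'X_{1..n}) == ((c u).1 + (c u).1)%MM)%:R +
  2^-1 * ((v : 'X_{1..n}) == ((c u).2 + (c u).2)%MM)%:R else 0.
have pick (V : lmodType R) (f : 'X_{1..n} -> V) m : (mdeg m < d)%N ->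
    \sum_(v : T) ((v : 'X_{1..n}) == m)%:R *: f v = f m.
  move=> md; rewrite (bigD1 (BMultinom md)) //= eqxx scale1r big1 ?addr0 // => v.
  by rewrite -val_eqE /= => /negPf ->; rewrite scale0r.
have AE (V : lmodType R) (f : 'X_{1..n} -> V) (u : T) : inner u ->
    \sum_v A u v *: f v = 2^-1 *: f ((c u).1 + (c u).1)%MM
                         + 2^-1 *: f ((c u).2 + (c u).2)%MM.
  move=> iu; have [_ /Ldeg d1 /Ldeg d2 _] := cP _ iu.
  rewrite -(pick _ f _ d1) -(pick _ f _ d2) !scaler_sumr -big_split /=.
  by apply: eq_bigr => v _; rewrite /A iu scalerDl !scalerA.
have minA (x : T -> R) : (forall u, \sum_v A u v * x v <= x u) -> forall u, 0 <= x u.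
  move=> Ax u; pose z (m : 'X_{1..n}) := oapp x 0 (insub m).
  have zE (v : T) : z v = x v by rewrite /z valK.
  have inT (m : 'X_{1..n}) : (mdeg m < d)%N -> m \in [seq bmnm v | v <- enum {: 'X_{1..n < d}}].
    by move=> md; apply/mapP; exists (BMultinom md); rewrite ?mem_enum.
  rewrite -zE; apply: (midpoint_min (x := z) _ (inT _ _)); last exact: bmdeg.
  move=> _ /mapP[v _ ->]; have [iv|niv] := boolP (inner v); last first.
    left; have := Ax v; rewrite big1 ?zE // => t _.
    by rewrite /A (negPf niv) mul0r.
  right; have [c12 /Ldeg d1 /Ldeg d2 vE] := cP _ iv.
  exists ((c v).1 + (c v).1)%MM, ((c v).2 + (c v).2)%MM; split; try exact: inT.
  - move=> /mnmP E; apply: c12; apply/mnmP => i; have := E i.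
    by rewrite !mnmDE; lia.
  - by rewrite vE; apply/mnmP => i; rewrite !mnmDE; lia.
  - have := Ax v.
    have -> : \sum_t A v t * x t = 2^-1 * z ((c v).1 + (c v).1)%MM
                                  + 2^-1 * z ((c v).2 + (c v).2)%MM.
      by rewrite -[RHS](AE R^o z v iv); apply: eq_bigr => t _; rewrite zE.
    by rewrite zE; lra.
have [g [g0 gE]] := nonneg_inverse minA (BMultinom (Ldeg _ Ly)).
rewrite -(FE _ Ly).
have -> : F y = \sum_u g u *: (F u - \sum_v A u v *: F v).
  exact: (gE _ (fun u : T => F u)).
apply: sos_sum => u; apply: sosZ => //.
have [iu|niu] := boolP (inner u); last first.
  rewrite /F (negPf niu) big1 ?subr0 => [|v _]; first exact: sos0.
  by rewrite /A (negPf niu) scale0r.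
have [_ L1 L2 uE] := cP _ iu; rewrite AE // (FE _ L1) (FE _ L2).
have [Lu _] := asboolW iu; rewrite (FE _ Lu) uE.
rewrite simplex_agiform_midpoint addrAC subrr add0r.
by apply: sosZ; [rewrite invr_ge0|exact: sos_sqr].
Qed.

End MediatedSimplex.

(** * Regular triangulations *)

Section Triangulation.
Variables (R : realType) (n N : nat) (v : 'I_N -> 'rV[R]_n) (Q : set 'rV[R]_n).
Hypotheses (Qv : Q = conv_hull (range v)) (vQ : range v = vertices Q).

Let simplex (s : {ffun 'I_n.+1 -> 'I_N}) : set 'rV[R]_n :=
  conv_hull (range (fun i => v (s i))).

Lemma rowsub_hmat (s : {ffun 'I_n.+1 -> 'I_N}) :
  rowsub s (hmat v) = hmat (fun i => v (s i)).
Proof. by apply/matrixP => i j; rewrite !mxE. Qed.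

Lemma full_dim_row_full : full_dimensional Q -> row_full (hmat v).
Proof.
move=> [w [wi wQ]].
have /choice[l lP] i : exists l : 'rV[R]_N, l *m hmat v = hvec (w i).
  have : conv_hull (range v) (w i) by rewrite -Qv; apply: wQ; exists i.
  by move=> /conv_hull_rangeP[l [_ lE]]; exists l.
have E : (\matrix_i l i) *m hmat v = hmat w.
  by apply/row_matrixP => i; rewrite row_mul !rowK.
rewrite /row_full eqn_leq rank_leq_col /=.
have /eqP {1}<- : \rank (hmat w) == n.+1.
  by rewrite -[_ == _]/(row_full _) row_full_unit -aff_indepE.
by rewrite -E mxrankM_maxr.
Qed.

Lemma basis_simplexP s p : basis (hmat v) s ->
  simplex s p <-> forall i, 0 <= coords (hmat v) s (hvec p) 0 i.
Proof.
move=> bs; split=> [/conv_hull_rangeP[l [l0]]|p0].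
  by rewrite -rowsub_hmat => E i; rewrite /coords -E mulmxK.
apply/conv_hull_rangeP; exists (coords (hmat v) s (hvec p)); split=> //.
by rewrite -rowsub_hmat coordsK.
Qed.

(** The simplices are the lower bases for generic heights vanishing on a basis
    that contains J; this basis is itself lower since its interpolation is 0. *)
Lemma extend_to_triangulation (J : {set 'I_N}) :
  full_dimensional Q -> indep (hmat v) J ->
  exists T s, [/\ triangulation_without_new_vertices Q T, basis (hmat v) s,
    {subset J <= codom s} & T (simplex s)].
Proof.
move=> /full_dim_row_full full /(extend_basis full)[s0 bs0 Js0].
have [om gen low0] := heightsP bs0.
exists [set S | exists2 s, lower (hmat v) om s & S = simplex s], s0.
split=> //; last by exists s0.
have simplex_vert s : lower (hmat v) om s ->
    vertices (simplex s) = range (fun i => v (s i)).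
  by move=> /andP[bs _]; rewrite simplex_vertices // -rowsub_hmat.
split.
- apply: (sub_finite_set (B := simplex @` [set: {ffun 'I_n.+1 -> 'I_N}])).
    by move=> _ [s _ ->]; exists s.
  exact/finite_image/finite_finset.
- move=> _ [s ls ->]; split.
    exists (fun i => v (s i)); split=> //.
    by rewrite aff_indepE -rowsub_hmat; case/andP: ls.
  by rewrite simplex_vert // -vQ => _ [i _ <-]; exists (s i).
- apply/seteqP; split=> [p [_ [s _ ->]]|p].
    by rewrite Qv; apply: conv_hull_mono => _ [i _ <-]; exists (s i).
  rewrite Qv => /conv_hull_rangeP[l [l0 lp]].
  have [s ls s0p] := lower_cover gen low0 l0.
  exists (simplex s); first by exists s.
  by apply/basis_simplexP; [case/andP: ls|rewrite -lp].
- move=> _ _ [s ls ->] [s' ls' ->].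
  have [bs bs'] : basis (hmat v) s /\ basis (hmat v) s'.
    by case/andP: ls => ? _; case/andP: ls'.
  exists (range (fun i => v (s i)) `&` range (fun i => v (s' i))); split.
    by rewrite !simplex_vert.
  apply/seteqP; split=> [p [/(basis_simplexP _ bs) ps /(basis_simplexP _ bs') ps']|p Wp].
    pose c := coords (hmat v) s' (hvec p).
    have meet i : c 0 i != 0 -> s' i \in codom s.
      exact: (lower_meet gen ls ls' ps ps').
    have /hmatP[c1 cp] : c *m hmat (fun i => v (s' i)) = hvec p.
      by rewrite -rowsub_hmat coordsK.
    have [i0 ci0] : exists i, c 0 i != 0.
      apply: contrapT => /forallNP c0; move: c1; rewrite big1 => [/eqP|i _].
        by rewrite eq_sym oner_eq0.
      by apply: contrapT => /eqP /c0.
    (* Vertices of zero weight need not be common; any common one replaces them. *)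
    exists n.+1, (c 0), (fun i => if c 0 i == 0 then v (s' i0) else v (s' i)).
    split=> // [i|].
      by case: ifPn => [_|ci]; (split; last by [exists i0|exists i]);
        [have /codomP[k ->] := meet _ ci0|have /codomP[k ->] := meet _ ci]; exists k.
    by rewrite -cp; apply: eq_bigr => i _; case: eqP => // ->; rewrite !scale0r.
  by split; move: p Wp; apply: conv_hull_mono => p [].
Qed.

End Triangulation.

(** * Vertices, weights and the Newton polytope *)

Section VertexEnumeration.
Variables (R : realType) (n : nat).
Implicit Types (Q : set 'rV[R]_n) (y : 'X_{1..n}).

Lemma interior_not_vertex Q p : (0 < n)%N -> interior Q p -> ~ vertices Q p.
Proof.
move=> n0 /nbhs_ballP[e /= e0 eQ] [_ ext].
pose d : 'rV[R]_n := const_mx (e / 2).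
have e2 : 0 < e / 2 by rewrite divr_gt0.
have near_p (q : 'rV[R]_n) : (forall i, `|p 0 i - q 0 i| < e) -> Q q.
  by move=> pq; apply: eQ; split=> // i j; rewrite (ord1 i); apply: pq.
have [||||+ _] := ext (p + d) (p - d) 2^-1.
- apply: near_p => i; rewrite !mxE opprD addrA subrr add0r normrN gtr0_norm //.
  by rewrite ltr_pdivrMr // ltr_pMr // ltr1n.
- apply: near_p => i; rewrite !mxE opprB addrCA subrr addr0 gtr0_norm //.
  by rewrite ltr_pdivrMr // ltr_pMr // ltr1n.
- by rewrite invr_gt0 ltr0n /= invf_lt1 ?ltr1n.
- by apply/rowP => i; rewrite !mxE; lra.
move=> /rowP/(_ (Ordinal n0)); rewrite !mxE => /eqP.
by rewrite -subr_eq0 addrAC subrr add0r gt_eqF.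
Qed.

Lemma lattice_polytope_vertices Q : lattice_polytope Q ->
  (forall p, vertices Q p -> exists v, p = mpoint R v) ->
  exists N (m : 'I_N -> 'X_{1..n}), [/\ injective m, vertex_monomials Q = range m,
    range (fun j => mpoint R (m j)) = vertices Q
    & Q = conv_hull (range (fun j => mpoint R (m j)))].
Proof.
move=> [V [finV QV]] vQ.
have range_tnth (T : eqType) (t : seq T) : [set` t] = range (tnth (in_tuple t)).
  apply/seteqP; split=> [x /= xt|_ [i _ <-] /=]; last exact: mem_tnth.
  by have [i ->] := tnthP (in_tuple t) x xt; exists i.
have [t tV] : exists t : seq 'rV[R]_n, zpoint R @` V = [set` t].
  by apply/finite_seqP/finite_image.
have finQ : finite_set (vertices Q).
  by apply: (sub_finite_set (B := [set` t])) => //; rewrite -tV QV;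
    apply: vertices_conv_hull.
have [r rE] : exists r : seq 'X_{1..n}, vertex_monomials Q = [set` r].
  apply/finite_seqP; apply: finite_preimage finQ => a b _ _.
  exact: mpoint_inj.
exists (size (undup r)), (tnth (in_tuple (undup r))).
have mE : vertex_monomials Q = range (tnth (in_tuple (undup r))).
  by rewrite rE -range_tnth; apply/seteqP; split=> x /=; rewrite mem_undup.
have pE : range (fun j => mpoint R (tnth (in_tuple (undup r)) j)) = vertices Q.
  apply/seteqP; split=> [_ [j _ <-]|p vp].
    have : range (tnth (in_tuple (undup r))) (tnth (in_tuple (undup r)) j) by exists j.
    by rewrite -mE.
  have [a pa] := vQ _ vp; have : vertex_monomials Q a by rewrite /vertex_monomials /= -pa.
  by rewrite mE => -[j _ ja]; exists j; rewrite ?ja.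
split=> //.
  by apply/(tuple_uniqP (in_tuple (undup r))); exact: undup_uniq.
rewrite pE; have QE : Q = conv_hull (range (tnth (in_tuple t))).
  by rewrite -range_tnth -tV.
apply/seteqP; split.
  by move=> p; rewrite QE; apply: conv_hull_vertices.
rewrite {2}QE; apply: conv_hull_min => p [Qp _]; by rewrite -QE.
Qed.

Lemma fsbig_vertices (V : zmodType) Q N (m : 'I_N -> 'X_{1..n}) (F : 'X_{1..n} -> V) :
  injective m -> vertex_monomials Q = range m ->
  \sum_(v \in vertex_monomials Q) F v = \sum_j F (m j).
Proof.
move=> mi ->.
have -> : range m = [set` [seq m j | j <- enum 'I_N]].
  apply/seteqP; split=> [_ [j _ <-]|x /= /mapP[j _ ->]]; last by exists j.
  by rewrite /= map_f // mem_enum.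
rewrite -fsbig_seq ?big_map ?big_enum //.
by rewrite map_inj_uniq ?enum_uniq.
Qed.

End VertexEnumeration.

Section Weights.
Variables (R : realType) (n N : nat) (Q : set 'rV[R]_n) (m : 'I_N -> 'X_{1..n}).
Variable (y : 'X_{1..n}).
Hypotheses (m_inj : injective m) (mQ : vertex_monomials Q = range m).

Definition row_agiform (l : 'rV[R]_N) : {mpoly R[n]} :=
  \sum_j l 0 j *: 'X_[m j] - 'X_[y].

(** The inverse of restricting weights to the enumerated vertices, extended by
    zero to the other exponents. *)
Definition weights_of_row (l : 'rV[R]_N) (v : 'X_{1..n}) : R :=
  \sum_(j | m j == v) l 0 j.

Lemma weights_of_rowE l j : weights_of_row l (m j) = l 0 j.
Proof. by rewrite /weights_of_row (big_pred1 j) // => k; rewrite (inj_eq m_inj). Qed.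

Lemma weighted_agiformE lambda :
  weighted_agiform Q lambda y = row_agiform (\row_j lambda (m j)).
Proof.
rewrite /weighted_agiform (fsbig_vertices _ m_inj mQ); congr (_ - _).
by apply: eq_bigr => j _; rewrite mxE.
Qed.

Lemma barycentric_rowP lambda : barycentric_weights Q y lambda ->
  (forall j, 0 <= (\row_j lambda (m j)) 0 j) /\
  (\row_j lambda (m j)) *m hmat (fun j => mpoint R (m j)) = hvec (mpoint R y).
Proof.
rewrite /barycentric_weights /= !(fsbig_vertices _ m_inj mQ) => -[ly l1 l0 _].
split=> [j|]; first by rewrite mxE.
apply/hmatP; split; [rewrite -l1|rewrite -ly];
  by apply: eq_bigr => j _; rewrite mxE.
Qed.

Lemma weights_of_row_barycentric (l : 'rV[R]_N) :
  (forall j, 0 <= l 0 j) -> l *m hmat (fun j => mpoint R (m j)) = hvec (mpoint R y) ->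
  barycentric_weights Q y (weights_of_row l).
Proof.
move=> l0 /hmatP[l1 ly]; rewrite /barycentric_weights /= !(fsbig_vertices _ m_inj mQ).
split=> [|||v].
- by rewrite -ly; apply: eq_bigr => j _; rewrite weights_of_rowE.
- by rewrite -l1; apply: eq_bigr => j _; rewrite weights_of_rowE.
- by move=> v; apply: sumr_ge0.
- rewrite mQ => nv; rewrite /weights_of_row big_pred0 // => j.
  by apply/eqP => jv; apply: nv; exists j.
Qed.

Lemma row_agiform_sosD (a b : 'rV[R]_N) (t : R) : 0 < t < 1 ->
  sum_of_squares (row_agiform a) -> sum_of_squares (row_agiform b) ->
  sum_of_squares (row_agiform (t *: a + (1 - t) *: b)).
Proof.
move=> /andP[t0 t1] sa sb.
have -> : row_agiform (t *: a + (1 - t) *: b) =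
    t *: row_agiform a + (1 - t) *: row_agiform b.
  rewrite /row_agiform !scalerBr addrACA -opprD -scalerDl [t + _]addrC subrK scale1r.
  rewrite !scaler_sumr -big_split /=; congr (_ - _); apply: eq_bigr => j _.
  by rewrite !mxE scalerDl !scalerA.
by apply: sosD; apply: sosZ; rewrite ?subr_ge0 ?ltW.
Qed.

End Weights.

(** The vertices of Q carry positive coefficients, and X^y cannot cancel them
    because y is not a vertex; the remaining exponent y lies in Q. *)
Lemma newton_polytope_agiform (R : realType) n (Q : set 'rV[R]_n) y f N
    (m : 'I_N -> 'X_{1..n}) :
  injective m -> vertex_monomials Q = range m ->
  Q = conv_hull (range (fun j => mpoint R (m j))) ->
  Q (mpoint R y) -> (forall j, y <> m j) -> agiform Q y f -> newton_polytope f = Q.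
Proof.
move=> mi mQ QE Qy ym [b [c [fE b0 _ _ _]]].
have coef v : f@_v = \sum_j b (m j) * (m j == v)%:R + c * (y == v)%:R.
  rewrite fE /ap_poly (fsbig_vertices _ mi mQ) mcoeffD raddf_sum /=.
  rewrite mcoeffZ mcoeffX; congr (_ + _).
  by apply: eq_bigr => j _; rewrite mcoeffZ mcoeffX.
apply/seteqP; split; [rewrite [X in _ `<=` X]QE|rewrite [X in X `<=` _]QE].
  apply: conv_hull_min => _ [v /= vf <-]; rewrite -QE.
  have [->//|/eqP yv] := pselect (v = y).
  have [[j jv]|/forallNP nj] := pselect (exists j, m j = v).
    by rewrite QE; apply: conv_hull_sub; exists j => //; rewrite jv.
  move: vf; rewrite mcoeff_msupp coef [y == v]eq_sym (negPf yv) mulr0 addr0 big1 ?eqxx //.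
  by move=> j _; case: eqP => [/nj//|_]; rewrite mulr0.
apply: conv_hull_mono => _ [j _ <-]; exists (m j) => //=.
rewrite mcoeff_msupp coef; have /eqP/negPf -> := ym j.
rewrite mulr0 addr0 (bigD1 j) //= eqxx mulr1 big1 ?addr0.
  by rewrite gt_eqF // b0 // mQ; exists j.
by move=> k kj; rewrite (inj_eq mi) (negPf kj) mulr0.
Qed.

(** * The characterisation *)

Theorem theorem8p2 (R : realType) (n : nat) (hn : (0 < n)%N)
    (Q : set 'rV[R]_n) (y : 'X_{1..n}) (f : {mpoly R[n]})
    (Qlattice : lattice_polytope Q)
    (Qdim : full_dimensional Q)
    (Qeven : forall p : 'rV[R]_n, vertices Q p ->
       exists v : 'X_{1..n}, p = mpoint R v /\ forall i, ~~ odd (v i))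
    (yint : interior Q (mpoint R y))
    (fAP : AP Q y f)
    (fagi : agiform Q y f) :
  SOS_weights f y = barycentric_weights Q y <->
  (forall T : set (set 'rV[R]_n), triangulation_without_new_vertices Q T ->
     forall S : set 'rV[R]_n, T S ->
       S (mpoint R y) -> max_mediated S (mexponent y)).
Proof.
have [|N [m [mi mQ vQ QE]]] := lattice_polytope_vertices Qlattice.
  by move=> p /Qeven[v [-> _]]; exists v.
have ym j : y <> m j.
  move=> yj; apply: (interior_not_vertex hn yint); rewrite yj -vQ; by exists j.
have NQ : newton_polytope f = Q.
  apply: (newton_polytope_agiform mi mQ QE _ ym fagi); exact: interior_subset.
(* Both sides are transported to weight rows indexed by the vertices. *)
set H := hmat (fun j => mpoint R (m j)).
have -> : (SOS_weights f y = barycentric_weights Q y) <->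
    forall l : 'rV[R]_N, (forall j, 0 <= l 0 j) -> l *m H = hvec (mpoint R y) ->
      sum_of_squares (row_agiform m y l).
  rewrite /SOS_weights NQ; split=> [E l l0 lH|sosl].
    have := weights_of_row_barycentric mi mQ l0 lH; rewrite -E => -[_].
    rewrite (weighted_agiformE _ mi mQ); congr (sum_of_squares (row_agiform _ _ _)).
    by apply/rowP => j; rewrite mxE weights_of_rowE.
  apply/seteqP; split=> [l []//|l bl]; split=> //.
  rewrite (weighted_agiformE _ mi mQ); have [l0 lH] := barycentric_rowP mi mQ bl.
  exact: sosl.
have agiE (s : {ffun 'I_n.+1 -> 'I_N}) :
    row_agiform m y (spread s (coords H s (hvec (mpoint R y)))) =
    simplex_agiform R (fun i => m (s i)) y.
  rewrite /row_agiform spread_sum /simplex_agiform /bary /coords.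
  by rewrite (rowsub_hmat (fun j => mpoint R (m j))).
split=> [sosl T [_ TQ _ _] S TS Sy|med].
  have [[w [wi SE]] vS] := TQ S TS.
  have uw : hmat w \in unitmx by rewrite -aff_indepE.
  have /choice[k kw] i : exists j, mpoint R (m j) = w i.
    have : vertices Q (w i).
      by apply: vS; rewrite SE simplex_vertices //; exists i.
    by rewrite -vQ => -[j _ jw]; exists j.
  pose s := finfun k.
  have wE : w = (fun i => mpoint R (m (s i))) by apply/funext => i; rewrite ffunE kw.
  have us : hmat (fun i => mpoint R (m (s i))) \in unitmx by rewrite -wE.
  have bs : basis H s by rewrite /basis (rowsub_hmat (fun j => mpoint R (m j))).
  move: Sy; rewrite SE wE => /(basis_simplexP (v := fun j => mpoint R (m j)) _ bs) y0.
  (* Of the simplex agiform only the vertices have positive coefficients. *)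
  apply: (sos_mediated us (g := simplex_agiform R (fun i => m (s i)) y)).
  - rewrite -agiE; apply: sosl => [j|]; last by rewrite spreadE coordsK.
    by rewrite mxE; apply: sumr_ge0.
  - move=> v vw; rewrite mcoeffB raddf_sum /= mcoeffX big1 ?sub0r ?oppr_le0 ?ler0n //.
    move=> i _; rewrite mcoeffZ mcoeffX; case: eqP => [/esym/vw//|_].
    by rewrite mulr0.
  - rewrite mcoeffB raddf_sum /= mcoeffX eqxx big1 ?sub0r ?oppr_lt0 ?ltr01 //.
    move=> i _; rewrite mcoeffZ mcoeffX; case: eqP => [/esym/ym//|_].
    by rewrite mulr0.
apply: indep_support_ind => [mu muH|a b t|l l0 lH ind].
- have := muH; rewrite mul_hmat => /hpair_eq0[]; exact: id.
- exact: row_agiform_sosD.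
have [T [s [TT bs ls TS]]] := extend_to_triangulation QE vQ Qdim ind.
have us : hmat (fun i => mpoint R (m (s i))) \in unitmx.
  by rewrite -(rowsub_hmat (fun j => mpoint R (m j))).
have lE : l = spread s (coords H s (hvec (mpoint R y))).
  have lsp : l = spread s (\row_i l 0 (s i)).
    apply: (spread_supported bs) => j js; apply/eqP; apply: contraNT js => lj.
    by apply: ls; rewrite inE.
  by rewrite {1}lsp; congr spread; rewrite -lH {2}lsp spreadE /coords mulmxK.
have Sy : conv_hull (range (fun i => mpoint R (m (s i)))) (mpoint R y).
  apply/(basis_simplexP (v := fun j => mpoint R (m j)) _ bs) => i.
  by rewrite -(spread_in _ i bs) -lE.
have [L ML Ly] := med T TT _ TS Sy.
by rewrite lE agiE; apply: (mediated_sos us ML Ly).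
Qed.
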